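(* Let $A$ be an operator given by $A\gamma_n=\lambda_n\gamma_n$ ($n\in\mathbb{Z}\setminus\{0\}$), where $(\lambda_n)$ are real numbers with $|\lambda_n|\le C|n|^\alpha$ for some constants $C$ and $\alpha$. Then the deformations $*_h^A$ and $*_h$ are equivalent on the Hida test functional space $W\cdot N_{\infty-}$; that is, there is a formal series $T=\mathrm{Id}+\sum_{r\ge1}h^rT_r$ of continuous linear operators $T_r$ on $W\cdot N_{\infty-}$, extended $\mathbb{C}[[h]]$-linearly to $W\cdot N_{\infty-}[[h]]$, such that $T(F_1*_h^AF_2)=(TF_1)*_h(TF_2)$ for all $F_1,F_2\in W\cdot N_{\infty-}[[h]]$.
   Context: Basis. $H$ is the Hilbert space of maps $\gamma:[0,1]\to\mathbb{R}$ with $\gamma(0)=\gamma(1)=0$ and $\|\gamma\|_0^2=\int_0^1|\gamma'(s)|^2ds<\infty$, with orthonormal basis $\gamma_n(s)=\frac{\sin(2\pi ns)}{cn}$ for $n>0$ and $\gamma_n(s)=\frac{\cos(2\pi ns)-1}{cn}$ for $n<0$ ($c=\sqrt2\,\pi$ the normalizing constant). $H_t=H\oplus H^*$, with $H^*\simeq H$, carries its canonical constant symplectic form; its basis vectors are indexed by pairs $(n,j)$, $n\in\mathbb{Z}\setminus\{0\}$, $j\in\{1,2\}$, where $j=1$ corresponds to $\gamma_n$ in $H$ and $j=2$ to $\gamma_n$ in $H^*\simeq H$. Hida space. A multiindex $I$ is a finite multiset (possibly empty) $\{(n_1,j_1),\dots,(n_{|I|},j_{|I|})\}$ of such pairs,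 with Hida weight $w_r(I)=\prod_{q=1}^{|I|}\big(\sqrt{C_1n_q^2+1}\big)^r$ ($C_1>0$ a fixed constant). $F^I$ is the normalized symmetric tensor product of the corresponding basis vectors ($F^\emptyset=1$). For $r,C>0$, $W\cdot N_{r,C}$ is the Hilbert space of series $F=\sum_Ib_IF^I$, $b_I\in\mathbb{C}$, with $\|F\|_{r,C}^2=\sum_I|b_I|^2w_r(I)C^{|I|}<\infty$, and $W\cdot N_{\infty-}=\bigcap_{r>0,C>0}W\cdot N_{r,C}$ with its Fréchet topology. $W\cdot N_{\infty-}[[h]]$ is the space of formal power series in $h$ with coefficients in $W\cdot N_{\infty-}$. The Wick product is $\colon F^{I_1}F^{I_2}\colon=F^{I_1\cup I_2}$ ($\cup$ = concatenation of multisets), extended bilinearly to series: the coefficient of $F^I$ in $\colon F_1F_2\colon$ is $\sum_{I_1\cup I_2=I}b^1_{I_1}b^2_{I_2}$. Annihilation operators. $a_n^j$ is the linear operator with $a_n^jF^I=m\,F^{I\setminus\{(n,j)\}}$, $m$ being the multiplicity of $(n,j)$ in $I$ (and $a_n^jF^I=0$ if $m=0$); $a_n^1$ is the annihilation operator in the direction of $H$ and $a_n^2$ that in the direction of $H^*\simeq H$, associated to $\gamma_n$. Products. The canonical Poisson bracket is $\{F_1,F_2\}=\sum_n\colon a_n^1F_1\,a_n^2F_2\colon-\sum_n\colon a_n^2F_1\,a_n^1F_2\colon$. Put $E_A[F_1,F_2]=\sum_n\colon a_n^1F_1\,\lambda_na_n^2F_2\colon+\sum_n\colon a_n^1F_2\,\lambda_na_n^2F_1\colon$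 and $C_1^A[F_1,F_2]=\{F_1,F_2\}+E_A[F_1,F_2]$. For $r\ge1$, $C_r^A=(C_1^A)^r$ in the sense of bidifferential operators: $C_r^A[F_1,F_2]=\mu\big(B_A^r(F_1\otimes F_2)\big)$, where $\mu(F\otimes G)=\colon FG\colon$ and $B_A=\sum_n\big[(1+\lambda_n)\,a_n^1\otimes a_n^2+(\lambda_n-1)\,a_n^2\otimes a_n^1\big]$. All these bilinear maps are defined on finite sums and extended continuously to $W\cdot N_{\infty-}\times W\cdot N_{\infty-}$. For $F_1,F_2\in W\cdot N_{\infty-}$, $$F_1*_h^AF_2=\colon F_1F_2\colon+\sum_{r\ge1}\frac{h^r}{r!}C_r^A[F_1,F_2],$$ extended $\mathbb{C}[[h]]$-bilinearly to $W\cdot N_{\infty-}[[h]]$, and $*_h$ is the product obtained for $A=0$ (the Moyal product). *)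

(* Defs.v *)
From HB Require Import structures.
From mathcomp Require Import all_boot all_order all_algebra finmap multiset.
From mathcomp Require Import complex ring.
From mathcomp Require Import all_classical all_reals all_analysis.

Set Implicit Arguments.
Unset Strict Implicit.
Unset Printing Implicit Defensive.

Import Order.TTheory GRing.Theory Num.Theory.

Local Open Scope classical_set_scope.
Local Open Scope ring_scope.

Definition mode := {n : int | n != 0}.

(* A pair (n, j) indexes a basis vector of H_t = H (+) H^*; the boolean is
   false for j = 1 (gamma_n in H) and true for j = 2 (gamma_n in H^* ~ H). *)
Definition idx := (mode * bool)%type.
Definition dirH (n : mode) : idx := (n, false).
Definition dirHdual (n : mode) : idx := (n, true).

Definition multiindex := {mset idx}%mset.

Section Space.
Variable R : realType.
Local Notation C := R[i].
Local Notation normc := ComplexField.Normc.normc.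

(* A family (b_I) stands for the formal series sum_I b_I F^I. *)
Definition coef := multiindex -> C.

Definition basis (I : multiindex) : coef := fun J => (J == I)%:R.

(* The norm of W.N_{r,c} gives F^I squared length w_r(I) c^|I|, whatever the
   direction j of the pairs in I; hida_rc is W.N_{r,c} and hida_set, hence the
   type hida below, is W.N_{oo-}. *)
Definition hida_weight (C1 r : R) (I : multiindex) : R :=
  \prod_(x <- enum_mset I) Num.sqrt (C1 * (val x.1)%:~R ^+ 2 + 1) `^ r.

Definition hida_sqnorm (C1 r c : R) (b : coef) : \bar R :=
  \esum_(I in [set: multiindex])
    (normc (b I) ^+ 2 * hida_weight C1 r I * c ^+ size (enum_mset I))%:E.

Definition hida_rc (C1 r c : R) : set coef :=
  [set b | (hida_sqnorm C1 r c b < +oo)%E].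

Definition hida_set (C1 : R) : set coef :=
  \bigcap_(p in [set p : R * R | 0 < p.1 /\ 0 < p.2]) hida_rc C1 p.1 p.2.

Definition hida_pred (C1 : R) : {pred coef} := fun b => `[< hida_set C1 b >].

Fact hida_weight_ge0 C1 r I : 0 <= hida_weight C1 r I.
Proof. by rewrite /hida_weight prodr_ge0// => x _; exact: powR_ge0. Qed.

Fact hida_term_ge0 C1 r c (b : coef) I : 0 < c ->
  0 <= normc (b I) ^+ 2 * hida_weight C1 r I * c ^+ size (enum_mset I).
Proof.
move=> c0; apply: mulr_ge0; last by rewrite exprn_ge0// ltW.
by rewrite mulr_ge0 ?sqr_ge0 ?hida_weight_ge0.
Qed.

Fact esumZ_lty (T : choiceType) (k : R) (f : T -> \bar R) :
  0 <= k -> (forall i, 0 <= f i)%E -> (\esum_(i in [set: T]) f i < +oo)%E ->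
  (\esum_(i in [set: T]) (k%:E * f i) < +oo)%E.
Proof.
move=> k0 f0 foo.
have S0 : (0 <= \esum_(i in [set: T]) f i)%E by exact: esum_ge0.
apply: (@le_lt_trans _ _ (k%:E * \esum_(i in [set: T]) f i)%E); last first.
  by apply: lte_mul_pinfty => //; rewrite ge0_fin_numE.
apply: ge_ereal_sup => _ [A [finA _] <-].
rewrite fsbig_finite//= -ge0_sume_distrr; last by [].
rewrite lee_wpmul2l ?lee_fin//; apply: esum_ge; exists A; first by split.
by rewrite fsbig_finite.
Qed.

Fact hida_submod_closed C1 : submod_closed (hida_pred C1).
Proof.
split=> [|a u v /asboolP hu /asboolP hv]; apply/asboolP => -[r c] rc0.
  rewrite /hida_rc /= /hida_sqnorm esum1 ?ltry// => I _.
  by rewrite ComplexField.Normc.normc0 expr0n/= !mul0r.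
have {}hu := hu _ rc0; have {}hv := hv _ rc0; case: rc0 => /= r0 c0.
rewrite /hida_rc /= /hida_sqnorm in hu hv *.
pose W I := hida_weight C1 r I * c ^+ size (enum_mset I).
have W0 I : 0 <= W I by rewrite mulr_ge0 ?hida_weight_ge0// exprn_ge0// ltW.
have n0 (z : C) : 0 <= normc z by case: z => x y; exact: sqrtr_ge0.
pose f w (I : multiindex) := (normc (w I) ^+ 2 * hida_weight C1 r I
  * c ^+ size (enum_mset I))%:E.
have f0 w I : (0 <= f w I)%E by rewrite lee_fin hida_term_ge0.
have k0 : 0 <= 2 * normc a ^+ 2 by rewrite mulr_ge0 ?sqr_ge0.
apply: (@le_lt_trans _ _ (\esum_(I in [set: multiindex])
    ((2 * normc a ^+ 2)%:E * f u I + 2%:E * f v I))%E).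
  apply: le_esum => I _; rewrite -!EFinM -EFinD lee_fin.
  set x : R := normc a; set y : R := normc (u I); set z : R := normc (v I).
  have -> : 2 * x ^+ 2 * (y ^+ 2 * hida_weight C1 r I * c ^+ size (enum_mset I))
      + 2 * (z ^+ 2 * hida_weight C1 r I * c ^+ size (enum_mset I))
    = (2 * (x * y) ^+ 2 + 2 * z ^+ 2) * W I by rewrite /W; ring.
  rewrite -mulrA -/(W I) ler_wpM2r//.
  apply: (@le_trans _ _ ((x * y + z) ^+ 2)).
    rewrite ler_sqr ?nnegrE ?addr_ge0 ?mulr_ge0 ?n0//.
    by rewrite -ComplexField.Normc.normcM; exact: le_normcD.
  rewrite -subr_ge0.
  suff -> : 2 * (x * y) ^+ 2 + 2 * z ^+ 2 - (x * y + z) ^+ 2 = (x * y - z) ^+ 2.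
    exact: sqr_ge0.
  ring.
rewrite esumD => [|I _|I _]; first by rewrite lte_add_pinfty ?esumZ_lty.
  by rewrite mule_ge0.
by rewrite mule_ge0.
Qed.

HB.instance Definition _ C1 :=
  GRing.isSubmodClosed.Build _ _ (hida_pred C1) (hida_submod_closed C1).

Record hida (C1 : R) := Hida { hcoef : coef; hcoefP : hcoef \in hida_pred C1 }.

HB.instance Definition _ C1 := [isSub for @hcoef C1].
HB.instance Definition _ C1 := [Choice of hida C1 by <:].
HB.instance Definition _ C1 := [SubChoice_isSubLmodule of hida C1 by <:].

Definition hida_norm (C1 r c : R) (F : hida C1) : R :=
  Num.sqrt (fine (hida_sqnorm C1 r c (hcoef F))).

Definition hida_ball (C1 r c : R) (F : hida C1) (e : R) : set (hida C1) :=
  [set G | hida_norm r c (G - F) < e].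

(* The topology of the family of norms (r, c > 0): the coarsest one for which
   all the open balls are open. *)
Definition hida_balls (C1 : R) : set (set (hida C1)) :=
  [set U | exists r c e (F : hida C1),
     [/\ 0 < r, 0 < c, 0 < e & U = hida_ball r c F e]].

HB.instance Definition _ C1 :=
  isSubBaseTopological.Build (hida C1) (@hida_balls C1) id.

End Space.

Section Products.
Variable R : realType.
Local Notation C := R[i].
Local Notation coef := (coef R).

(* On the coefficient of F^J only F^(J + x) contributes, with multiplicity
   J x + 1; annih_basis is the defining formula. *)
Definition annih (x : idx) (F : coef) : coef :=
  fun J => (J x).+1%:R * F (x +` J)%mset.

Fact annih_basis x I :
  annih x (basis R I) = (I x)%:R *: basis R (I `\ x)%mset.
Proof.
apply/funext => J; rewrite /annih /basis scalrfctE /GRing.scale/=.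
have [eI|neI] := eqVneq (x +` J)%mset I.
  have <- : J = (I `\ x)%mset.
    by apply/msetP => y; rewrite -eI msetB1E mset1DE addKn.
  by rewrite eqxx !mulr1 -eI mset1DE eqxx add1n.
rewrite mulr0; have [->|Ix0] := posnP (I x); first by rewrite mul0r.
case: (J =P (I `\ x)%mset) => [eJ|_]; last by rewrite mulr0.
case/eqP: neI; apply/msetP => y; rewrite eJ mset1DE msetB1E.
by case: (y =P x) => [->|_] /=; rewrite ?subn1 ?add1n ?prednK ?subn0.
Qed.

(* An element of the tensor square is encoded by the array of its coefficients
   on the F^I (x) F^J. *)
Definition coef2 := multiindex -> multiindex -> C.

Definition tensor (F G : coef) : coef2 := fun I J => F I * G J.

Definition annih2 (x y : idx) (P : coef2) : coef2 :=
  fun I J => annih x (fun I' => annih y (P I') J) I.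

Fact annih2_tensor x y F G :
  annih2 x y (tensor F G) = tensor (annih x F) (annih y G).
Proof.
apply/funext => I; apply/funext => J.
by rewrite /annih2 /annih /tensor; ring.
Qed.

(* The operator A is diagonal, A gamma_n = lambda_n gamma_n, and enters only
   through its eigenvalues. This collects C_1^A = {.,.} + E_A, where
     {F, G} = sum_n a_n^1 F a_n^2 G - sum_n a_n^2 F a_n^1 G,
     E_A[F, G] = sum_n lambda_n (a_n^1 F a_n^2 G + a_n^2 F a_n^1 G).
   The sum over n has finite support when P has. *)
Definition bidiff (lambda : mode -> R) (P : coef2) : coef2 := fun I J =>
  \sum_(n \in [set: mode])
    ((1 + lambda n)%:C%C * annih2 (dirH n) (dirHdual n) P I J
     + (lambda n - 1)%:C%C * annih2 (dirHdual n) (dirH n) P I J).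

Definition wick (P : coef2) : coef := fun I =>
  \sum_(p \in [set p : multiindex * multiindex | (p.1 `+` p.2)%mset = I])
    P p.1 p.2.

(* C_r^A on finite sums; r = 0 gives the Wick product. *)
Definition Cfin (lambda : mode -> R) (r : nat) (F G : coef) : coef :=
  wick (iter r (bidiff lambda) (tensor F G)).

Definition finite_sum (F : coef) : Prop := finite_set [set I | F I != 0].

Definition continuous_extension (C1 : R) (B : coef -> coef -> coef) :
    set (hida C1 -> hida C1 -> hida C1) :=
  [set G | [/\ bilinear_for *:%R *:%R G,
              continuous (fun p : hida C1 * hida C1 => G p.1 p.2) &
              forall F1 F2, finite_sum (hcoef F1) -> finite_sum (hcoef F2) ->
                hcoef (G F1 F2) = B (hcoef F1) (hcoef F2)]].

(* The extension is unique since finite sums are dense and the topology is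
   separated; it exists for every lambda of at most polynomial growth, so the
   default value 0 is not used for such lambda. *)
Definition CA (C1 : R) (lambda : mode -> R) (r : nat) :
    hida C1 -> hida C1 -> hida C1 :=
  xget (fun _ _ => 0) (continuous_extension (Cfin lambda r)).

(* W.N_{oo-}[[h]] : u stands for sum_k h^k u_k. *)
Definition hida_series (C1 : R) := nat -> hida C1.

Definition star (C1 : R) (lambda : mode -> R) (F1 F2 : hida_series C1) :
    hida_series C1 := fun k =>
  \sum_(r < k.+1) \sum_(i < (k - r).+1)
    (r`!%:R : C)^-1 *: CA lambda r (F1 i) (F2 (k - r - i)%N).

Definition moyal (C1 : R) := @star C1 (fun=> 0).

Definition series_op (C1 : R) (T : nat -> hida C1 -> hida C1)
    (F : hida_series C1) : hida_series C1 := fun k =>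
  \sum_(i < k.+1) T i (F (k - i)%N).

End Products.

(* Main.v *)
Require Import Defs.
From HB Require Import structures.
From mathcomp Require Import all_boot all_order all_algebra finmap multiset.
From mathcomp Require Import complex ring lra.
From mathcomp Require Import all_classical all_reals all_analysis.

Set Implicit Arguments.
Unset Strict Implicit.
Unset Printing Implicit Defensive.

Import Order.TTheory GRing.Theory Num.Theory.

Local Open Scope classical_set_scope.
Local Open Scope ring_scope.

(** The equivalence is T = exp(- h D), where D is the second order operator
    D = sum_n lambda_n a_n^1 a_n^2.

    The algebraic reason is the following.  Annihilation operators are
    derivations of the Wick product mu, so that
    D o mu = mu o (D (x) 1 + 1 (x) D + E), with
    E = sum_n lambda_n (a_n^1 (x) a_n^2 + a_n^2 (x) a_n^1).  The operator that
    defines the product *_h^A is B + E, where B is the one that defines the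
    Moyal product, and all these operators commute, being polynomials in the
    a_n^j (x) 1 and 1 (x) a_n^j.  Hence
    exp(- h D) o mu o exp(h (B + E))
      = mu o exp(- h (D (x) 1 + 1 (x) D + E)) o exp(h (B + E))
      = mu o exp(h B) o (exp(- h D) (x) exp(- h D)),
    which is the required identity T(F *^A G) = (T F) * (T G).  In each degree
    of h it is proved with the sums over n restricted to a finite set of modes
    (truncated_intertwining), where the operators are defined on all arrays of
    coefficients and commute without any question of convergence.

    The analytic part passes to the infinite sums.  The sum over all multiindices
    of the inverse of a large power of the weights converges (nuclear).
    Consequently the Hilbert norms of W.N_{oo-} can be replaced with weighted
    sup norms, and the elements of W.N_{oo-} are the families of coefficients
    of rapid decay (rapid_hcoef, rapid_hida_pred, hida_nbhsP).  For these norms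
    the infinite sums over the modes converge absolutely, as
    sum_n 1 / n^2 is finite and lambda_n has polynomial growth, and they define
    bounded operators (decay_laplace_ext, decay_star_ext).  On finite sums these
    operators are the given ones, finite sums are dense (finite_sum_approx), and
    a continuous extension is unique (continuous_extension_unique), so that
    toser_CA computes the coefficients of C_r^A.  Finally the two sides of the
    identity in degree m of h are bounded biadditive maps that coincide on
    finite sums, since only finitely many modes occur there; so they coincide
    everywhere (intertwining), and the identity for power series in h follows by
    rearranging finite convolution sums (series_intertwining). *)

(** * Convolution sums *)

Section TriangularSums.
Variable V : nmodType.

(** Associativity of convolution: both sides run over i + j + l = n. *)
Lemma triangular_assoc n (f : nat -> nat -> nat -> V) :
  \sum_(i < n.+1) \sum_(j < (n - i).+1) f i j (n - i - j)%N
    = \sum_(m < n.+1) \sum_(i < m.+1) f i (m - i)%N (n - m)%N.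
Proof.
elim: n f => [|n IH] f; first by rewrite !big_ord1.
rewrite big_ord_recl /=.
under [in RHS]eq_bigr do rewrite big_ord_recl /=.
rewrite [RHS]big_split /=; congr (_ + _).
  by apply: eq_bigr => j _; rewrite [(j - 0)%N]subn0.
rewrite [RHS]big_ord_recl big_ord0 add0r.
by rewrite (IH (fun i => f i.+1)).
Qed.

Lemma triangular_swap n (f : nat -> nat -> nat -> V) :
  \sum_(i < n.+1) \sum_(j < (n - i).+1) f i j (n - i - j)%N
    = \sum_(j < n.+1) \sum_(i < (n - j).+1) f i j (n - j - i)%N.
Proof.
rewrite triangular_assoc (triangular_assoc n (fun j i => f i j)).
apply: eq_bigr => m _; rewrite (reindex_inj rev_ord_inj) /=.
by apply: eq_bigr => i _; rewrite subSS subKn// -ltnS.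
Qed.

(** Both sides run over a + b + j + l = n; the quadruples are grouped as
    (a, b), (j, l) on the left and as (a, j), (b, l) on the right. *)
Lemma triangular_interchange n (f : nat -> nat -> nat -> nat -> V) :
  \sum_(s < n.+1) \sum_(j < (n - s).+1) \sum_(a < s.+1)
      f a (s - a)%N j (n - s - j)%N
    = \sum_(s < n.+1) \sum_(a < s.+1) \sum_(b < (n - s).+1)
      f a b (s - a)%N (n - s - b)%N.
Proof.
under eq_bigr do rewrite exchange_big /=.
rewrite -(triangular_assoc n (fun a b t => \sum_(j < t.+1) f a b j (t - j)%N)).
rewrite -(triangular_assoc n (fun a j t => \sum_(b < t.+1) f a b j (t - b)%N)).
apply: eq_bigr => a _.
exact: (triangular_swap _ (fun b j t => f a b j t)).
Qed.

End TriangularSums.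

(** * Divided powers of commuting operators *)

Section DividedPowers.
Variables (K : numFieldType) (V : lmodType K) (X Y : {linear V -> V}).
Hypothesis XY : forall v, X (Y v) = Y (X v).

Definition divpow (f : V -> V) (m : nat) (v : V) : V := m`!%:R^-1 *: iter m f v.

Lemma divpowS f m v : m.+1%:R *: divpow f m.+1 v = m`!%:R^-1 *: f (iter m f v).
Proof.
by rewrite /divpow scalerA factS natrM invfM mulrA mulfV ?mul1r// pnatr_eq0.
Qed.

Lemma divpowSl (f : {linear V -> V}) m v :
  m.+1%:R *: divpow f m.+1 v = f (divpow f m v).
Proof. by rewrite divpowS linearZ. Qed.

Lemma divpow_commute i v : Y (divpow X i v) = divpow X i (Y v).
Proof.
rewrite /divpow linearZ /=; congr (_ *: _).
by elim: i => //= i <-; rewrite XY.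
Qed.

(** The coefficient of h^m in exp(h (X + Y)) = exp(h X) exp(h Y).  As in the
    case of numbers, (m + 1) times the coefficient of degree m + 1 is the sum of
    i times and m + 1 - i times each term, and i X^i / i! = X X^(i-1) / (i-1)!. *)
Lemma divpowD m v :
  divpow (fun w => X w + Y w) m v
    = \sum_(i < m.+1) divpow X i (divpow Y (m - i) v).
Proof.
elim: m => [|m IHm].
  by rewrite big_ord_recl big_ord0 addr0 /divpow /= !fact0 !invr1 !scale1r.
have m1 : m.+1%:R != 0 :> K by rewrite pnatr_eq0.
apply: (scalerI m1); rewrite divpowS.
transitivity (X (divpow (fun w => X w + Y w) m v)
              + Y (divpow (fun w => X w + Y w) m v)).
  by rewrite /divpow !linearZ -scalerDr.
rewrite IHm linear_sum linear_sum.
have e (i : 'I_m.+2) : m.+1%:R *: divpow X i (divpow Y (m.+1 - i) v)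
    = i%:R *: divpow X i (divpow Y (m.+1 - i) v)
      + (m.+1 - i)%:R *: divpow X i (divpow Y (m.+1 - i) v).
  by rewrite -scalerDl -natrD subnKC// -ltnS.
transitivity (\sum_(i < m.+2)
    (i%:R *: divpow X i (divpow Y (m.+1 - i) v)
      + (m.+1 - i)%:R *: divpow X i (divpow Y (m.+1 - i) v))); last first.
  by rewrite scaler_sumr; apply: eq_bigr => i _; rewrite e.
rewrite big_split; congr (_ + _).
  rewrite [RHS]big_ord_recl /= scale0r add0r.
  by apply: eq_bigr => i _; rewrite /= /bump leq0n add1n divpowSl subSS.
rewrite [RHS]big_ord_recr /= subnn scale0r addr0.
apply: eq_bigr => i _ /=; rewrite divpow_commute subSn -1?ltnS//.
rewrite -divpowSl /divpow; set k := (m - i)%N.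
have Z a (u : V) : iter i X (a *: u) = a *: iter i X u.
  by elim: (nat_of_ord i) => //= j ->; rewrite linearZ.
by rewrite !Z !scalerA; congr (_ *: _); ring.
Qed.

End DividedPowers.

(** * The Wick product and the Leibniz rule *)

Section Wick.
Variable R : realType.
Local Notation C := R[i].
Local Notation coef := (coef R).
Local Notation coef2 := (coef2 R).

Definition splits (I : multiindex) : set (multiindex * multiindex) :=
  [set p | (p.1 `+` p.2)%mset = I].

Lemma mset_ind (P : multiindex -> Prop) :
  P mset0 -> (forall x I, P I -> P (x +` I)%mset) -> forall I, P I.
Proof.
move=> P0 PS I; rewrite -(seq_mset_id I); elim: (enum_mset I) => [|x s IHs].
  suff -> : seq_mset [::] = mset0 :> multiindex by [].
  by apply/msetP => y; rewrite mset_seqE mset0E.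
suff -> : seq_mset (x :: s) = (x +` seq_mset s)%mset by exact: PS.
by apply/msetP => y; rewrite mset1DE !mset_seqE /= eq_sym.
Qed.

(** A splitting of x + I puts x into one of the two parts of a splitting of I. *)
Lemma finite_splits I : finite_set (splits I).
Proof.
elim/mset_ind: I => [|x I IH].
  apply: (@sub_finite_set _ _ [set (mset0, mset0)]); last exact: finite_set1.
  move=> [p q] /= pq0; congr (_, _); apply/msetP => y;
    have /(congr1 (fun I : multiindex => I y)) := pq0;
    rewrite msetE2 mset0E; by case: (p y) (q y) => [|?] [|?].
pose f (p : multiindex * multiindex) := ((x +` p.1)%mset, p.2).
pose g (p : multiindex * multiindex) := (p.1, (x +` p.2)%mset).
apply: (@sub_finite_set _ _ (f @` splits I `|` g @` splits I)); last first.
  by rewrite finite_setU; split; exact: finite_image.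
move=> [p q] /= pq.
have : x \in (p `+` q)%mset by rewrite (pq : (p `+` q)%mset = _) mset1D1.
rewrite in_msetD => /orP[xp|xq]; [left|right].
  exists ((p `\ x)%mset, q); rewrite /splits /f /= ?msetB1K//.
  rewrite -[RHS](msetD1K x) -(pq : (p `+` q)%mset = _).
  by rewrite -{2}(msetB1K xp) -msetDA msetD1K.
exists (p, (q `\ x)%mset); rewrite /splits /g /= ?msetB1K//.
rewrite -[RHS](msetD1K x) -(pq : (p `+` q)%mset = _) -{2}(msetB1K xq).
by rewrite msetDCA msetD1K.
Qed.

(** Named types with module structures of their own, so that unification does not
    unfold them into nested function types. *)
Definition ser := multiindex -> C.
Definition arr := multiindex -> multiindex -> C.

HB.instance Definition _ := Choice.copy ser (multiindex -> C).
HB.instance Definition _ := Choice.copy arr (multiindex -> multiindex -> C).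

Section Instances.
Let ser_add (F G : ser) : ser := fun I => F I + G I.
Let ser_opp (F : ser) : ser := fun I => - F I.
Let ser_scale (a : C) (F : ser) : ser := fun I => a * F I.
Let arr_add (F G : arr) : arr := fun I J => F I J + G I J.
Let arr_opp (F : arr) : arr := fun I J => - F I J.
Let arr_scale (a : C) (F : arr) : arr := fun I J => a * F I J.

Let ser_addA : associative ser_add.
Proof. by move=> F G H; apply/funext => I; exact: addrA. Qed.
Let ser_addC : commutative ser_add.
Proof. by move=> F G; apply/funext => I; exact: addrC. Qed.
Let ser_add0 : left_id (fun=> 0 : C) ser_add.
Proof. by move=> F; apply/funext => I; exact: add0r. Qed.
Let ser_addN : left_inverse (fun=> 0 : C) ser_opp ser_add.
Proof. by move=> F; apply/funext => I; exact: addNr. Qed.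
HB.instance Definition _ :=
  GRing.isZmodule.Build ser ser_addA ser_addC ser_add0 ser_addN.

Let ser_scaleA a b F : ser_scale a (ser_scale b F) = ser_scale (a * b) F.
Proof. by apply/funext => I; exact: mulrA. Qed.
Let ser_scale1 : left_id 1 ser_scale.
Proof. by move=> F; apply/funext => I; exact: mul1r. Qed.
Let ser_scaleDr : right_distributive ser_scale +%R.
Proof. by move=> a F G; apply/funext => I; exact: mulrDr. Qed.
Let ser_scaleDl F : {morph ser_scale^~ F : a b / a + b}.
Proof. by move=> a b; apply/funext => I; exact: mulrDl. Qed.
HB.instance Definition _ := GRing.Zmodule_isLmodule.Build C ser
  ser_scaleA ser_scale1 ser_scaleDr ser_scaleDl.

Let arr_addA : associative arr_add.
Proof. by move=> F G H; apply/funext => I; apply/funext => J; exact: addrA. Qed.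
Let arr_addC : commutative arr_add.
Proof. by move=> F G; apply/funext => I; apply/funext => J; exact: addrC. Qed.
Let arr_add0 : left_id (fun _ _ => 0 : C) arr_add.
Proof. by move=> F; apply/funext => I; apply/funext => J; exact: add0r. Qed.
Let arr_addN : left_inverse (fun _ _ => 0 : C) arr_opp arr_add.
Proof. by move=> F; apply/funext => I; apply/funext => J; exact: addNr. Qed.
HB.instance Definition _ :=
  GRing.isZmodule.Build arr arr_addA arr_addC arr_add0 arr_addN.

Let arr_scaleA a b F : arr_scale a (arr_scale b F) = arr_scale (a * b) F.
Proof. by apply/funext => I; apply/funext => J; exact: mulrA. Qed.
Let arr_scale1 : left_id 1 arr_scale.
Proof. by move=> F; apply/funext => I; apply/funext => J; exact: mul1r. Qed.
Let arr_scaleDr : right_distributive arr_scale +%R.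
Proof. by move=> a F G; apply/funext => I; apply/funext => J; exact: mulrDr. Qed.
Let arr_scaleDl F : {morph arr_scale^~ F : a b / a + b}.
Proof. by move=> a b; apply/funext => I; apply/funext => J; exact: mulrDl. Qed.
HB.instance Definition _ := GRing.Zmodule_isLmodule.Build C arr
  arr_scaleA arr_scale1 arr_scaleDr arr_scaleDl.
End Instances.

Lemma serD (F G : ser) I : (F + G) I = F I + G I. Proof. by []. Qed.
Lemma serZ a (F : ser) I : (a *: F) I = a * F I. Proof. by []. Qed.
Lemma arrD (P Q : arr) I J : (P + Q) I J = P I J + Q I J. Proof. by []. Qed.
Lemma arrZ a (P : arr) I J : (a *: P) I J = a * P I J. Proof. by []. Qed.

(* The given operations, typed as maps between these modules. *)
Definition swick (P : arr) : ser := wick P.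
Definition stensor (F G : ser) : arr := tensor F G.
Definition sannih (x : idx) (F : ser) : ser := annih x F.

Lemma wickE (P : arr) I : swick P I = \sum_(p <- fset_set (splits I)) P p.1 p.2.
Proof. by rewrite /swick /wick -fsbig_finite//; exact: finite_splits. Qed.

Lemma wick_is_linear : linear swick.
Proof.
move=> a P P'; apply/funext => I; rewrite serD serZ !wickE mulr_sumr -big_split.
exact: eq_bigr.
Qed.
HB.instance Definition _ :=
  GRing.isLinear.Build C arr ser _ swick wick_is_linear.

Definition annihl (x : idx) (P : arr) : arr :=
  fun I J => sannih x (P^~ J) I.
Definition annihr (x : idx) (P : arr) : arr := fun I J => sannih x (P I) J.

Lemma annih_is_linear x : linear (sannih x).
Proof.
by move=> a F G; apply/funext => I; rewrite serD serZ /sannih /annih serD serZ; ring.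
Qed.
HB.instance Definition _ x :=
  GRing.isLinear.Build C ser ser _ (sannih x) (annih_is_linear x).

Lemma annihl_is_linear x : linear (annihl x).
Proof.
move=> a P P'; apply/funext => I; apply/funext => J.
by rewrite arrD arrZ /annihl /sannih /annih arrD arrZ; ring.
Qed.
HB.instance Definition _ x :=
  GRing.isLinear.Build C arr arr _ (annihl x) (annihl_is_linear x).

Lemma annihr_is_linear x : linear (annihr x).
Proof.
move=> a P P'; apply/funext => I; apply/funext => J.
by rewrite arrD arrZ /annihr /sannih /annih arrD arrZ; ring.
Qed.
HB.instance Definition _ x :=
  GRing.isLinear.Build C arr arr _ (annihr x) (annihr_is_linear x).

Lemma annihC x y F : sannih x (sannih y F) = sannih y (sannih x F).
Proof.
apply/funext => I; rewrite /sannih /annih !mset1DE (eq_sym y x) msetDCA.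
by have [->|_] := eqVneq x y; rewrite ?add0n; ring.
Qed.

Lemma annihlC x y P : annihl x (annihl y P) = annihl y (annihl x P).
Proof.
by apply/funext => I; apply/funext => J; exact: (congr1 (@^~ I) (annihC x y _)).
Qed.

Lemma annihrC x y P : annihr x (annihr y P) = annihr y (annihr x P).
Proof.
by apply/funext => I; apply/funext => J; exact: (congr1 (@^~ J) (annihC x y _)).
Qed.

Lemma annihlrC x y P : annihl x (annihr y P) = annihr y (annihl x P).
Proof. by apply/funext => I; apply/funext => J; rewrite /annihl /annihr /sannih /annih; ring. Qed.

(** This lemma and the next are the two halves of the Leibniz rule.  The
    multiplicity of x in a sum of two multiindices is the sum of its
    multiplicities in both; the term of one of them vanishes unless x can be
    removed there, and the removal of x is then a bijection onto the splittings
    of I. *)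
Lemma wick_annihl (x : idx) (P : arr) (I : multiindex) :
  \sum_(p \in splits (x +` I)%mset) (p.1 x)%:R * P p.1 p.2 = swick (annihl x P) I.
Proof.
pose f (p : multiindex * multiindex) := ((x +` p.1)%mset, p.2).
transitivity (\sum_(p \in f @` splits I) (p.1 x)%:R * P p.1 p.2).
  apply/esym/fsbig_widen => [_ [p pI <-]|[p q] /= [pq npq]].
    by rewrite /splits /f /= -msetDA pI.
  have [->|px] := posnP (p x); first by rewrite mul0r.
  case: npq; exists ((p `\ x)%mset, q); rewrite /f /= ?msetB1K ?in_mset//.
  have xp : x \in (p : multiindex) by rewrite in_mset.
  rewrite /splits/= -[RHS](msetD1K x) -(pq : (p `+` q)%mset = _).
  by rewrite -{2}(msetB1K xp) -msetDA msetD1K.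
rewrite fsbig_image => [|[p q] [p' q'] _ _ [] /(congr1 (msetB^~ (msetn 1 x)))].
  apply: eq_fsbigr => p _.
  by rewrite /f/= mset1DE eqxx.
by rewrite !msetD1K => -> ->.
Qed.

Lemma wick_annihr (x : idx) (P : arr) (I : multiindex) :
  \sum_(p \in splits (x +` I)%mset) (p.2 x)%:R * P p.1 p.2 = swick (annihr x P) I.
Proof.
pose f (p : multiindex * multiindex) := (p.1, (x +` p.2)%mset).
transitivity (\sum_(p \in f @` splits I) (p.2 x)%:R * P p.1 p.2).
  apply/esym/fsbig_widen => [_ [p pI <-]|[p q] /= [pq npq]].
    by rewrite /splits /f /= msetDCA pI.
  have [->|px] := posnP (q x); first by rewrite mul0r.
  case: npq; exists (p, (q `\ x)%mset); rewrite /f /= ?msetB1K ?in_mset//.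
  have xp : x \in (q : multiindex) by rewrite in_mset.
  rewrite /splits/= -[RHS](msetD1K x) -(pq : (p `+` q)%mset = _).
  by rewrite -{2}(msetB1K xp) msetDCA msetD1K.
rewrite fsbig_image => [|[p q] [p' q'] _ _ [] -> /(congr1 (msetB^~ (msetn 1 x)))].
  apply: eq_fsbigr => p _.
  by rewrite /f/= mset1DE eqxx.
by rewrite !msetD1K => ->.
Qed.

(** Annihilation operators are derivations of the Wick product. *)
Lemma annih_wick (x : idx) (P : arr) :
  sannih x (swick P) = swick (annihl x P + annihr x P).
Proof.
rewrite linearD; apply/funext => I.
rewrite serD /= -wick_annihl -wick_annihr.
rewrite -(@fsbig_split _ _ _ +%R); last exact: finite_splits.
rewrite {1}/sannih /annih wickE mulr_sumr -fsbig_finite; last exact: finite_splits.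
apply: eq_fsbigr => p; rewrite inE /splits /= => pI.
rewrite -mulrDl -natrD; congr (_%:R * _).
have /(congr1 (fun I : multiindex => I x)) := pI.
by rewrite msetE2 mset1DE eqxx.
Qed.

End Wick.

(** * Quadratic operators in commuting families *)

Lemma divpow_morph (K : numFieldType) (V W : lmodType K) (h : {linear V -> W})
    (f : V -> V) (g : W -> W) m v : (forall u, h (f u) = g (h u)) ->
  h (divpow f m v) = divpow g m (h v).
Proof.
move=> hfg; rewrite /divpow linearZ /=; congr (_ *: _).
by elim: m => //= m <-; rewrite hfg.
Qed.

Lemma eq_divpow (K : numFieldType) (V : lmodType K) (f g : V -> V) m v :
  f =1 g -> divpow f m v = divpow g m v.
Proof. by move=> /eq_iter fg; rewrite /divpow fg. Qed.

Lemma divpow_sum (K : numFieldType) (V : lmodType K) (f : {linear V -> V}) m n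
    (u : 'I_n -> V) : divpow f m (\sum_i u i) = \sum_i divpow f m (u i).
Proof.
rewrite /divpow -scaler_sumr; congr (_ *: _).
by elim: m => //= m ->; rewrite linear_sum.
Qed.

Section Quadratic.
Variables (K : numFieldType) (V : lmodType K) (T : Type) (S : seq T).
Variables (a b a' b' : T -> {linear V -> V}).

(** With a, b the annihilation operators in the directions of H and H^* on the
    left tensor factor and a', b' those on the right one, the coefficients ll
    and rr give D (x) 1 and 1 (x) D, whereas lr and rl give the bidifferential
    operators of the products. *)
Definition quad (ll rr lr rl : T -> K) (v : V) : V :=
  \sum_(n <- S) (ll n *: a n (b n v) + rr n *: a' n (b' n v)
                 + lr n *: a n (b' n v) + rl n *: b n (a' n v)).

Lemma quad_is_linear ll rr lr rl : linear (quad ll rr lr rl).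
Proof.
move=> k u v; rewrite /quad scaler_sumr -big_split; apply: eq_bigr => n _ /=.
rewrite !linearP !scalerDr !scalerA ![k * _]mulrC.
by do 3!(rewrite [RHS]addrACA; congr (_ + _)).
Qed.

HB.instance Definition _ ll rr lr rl :=
  GRing.isLinear.Build K V V _ (quad ll rr lr rl) (quad_is_linear ll rr lr rl).

Lemma quadD ll rr lr rl ll' rr' lr' rl' v :
  quad ll rr lr rl v + quad ll' rr' lr' rl' v
    = quad (ll + ll') (rr + rr') (lr + lr') (rl + rl') v.
Proof.
rewrite /quad -big_split; apply: eq_bigr => n _ /=.
by rewrite !scalerDl addrACA; congr (_ + _); rewrite addrACA; congr (_ + _);
  rewrite addrACA.
Qed.

Lemma quad_ll ll v : quad ll 0 0 0 v = \sum_(n <- S) ll n *: a n (b n v).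
Proof.
have z n u : (0 : T -> K) n *: u = 0 :> V := scale0r u.
by apply: eq_bigr => n _; rewrite !z !addr0.
Qed.

Lemma quad_rr rr v : quad 0 rr 0 0 v = \sum_(n <- S) rr n *: a' n (b' n v).
Proof.
have z n u : (0 : T -> K) n *: u = 0 :> V := scale0r u.
by apply: eq_bigr => n _; rewrite !z !addr0 add0r.
Qed.

Lemma quad_lrrl lr rl v : quad 0 0 lr rl v
  = \sum_(n <- S) (lr n *: a n (b' n v) + rl n *: b n (a' n v)).
Proof.
have z n u : (0 : T -> K) n *: u = 0 :> V := scale0r u.
by apply: eq_bigr => n _; rewrite !z !add0r.
Qed.

Lemma commute_quad ll rr lr rl (f : {linear V -> V}) v :
  (forall n u, f (a n u) = a n (f u)) -> (forall n u, f (b n u) = b n (f u)) ->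
  (forall n u, f (a' n u) = a' n (f u)) -> (forall n u, f (b' n u) = b' n (f u)) ->
  f (quad ll rr lr rl v) = quad ll rr lr rl (f v).
Proof.
move=> fa fb fa' fb'; rewrite /quad linear_sum; apply: eq_bigr => n _ /=.
by rewrite !linearD !linearZ /= !(fa, fb, fa', fb').
Qed.

Hypothesis aa : forall m n v, a m (a n v) = a n (a m v).
Hypothesis bb : forall m n v, b m (b n v) = b n (b m v).
Hypothesis aa' : forall m n v, a' m (a' n v) = a' n (a' m v).
Hypothesis bb' : forall m n v, b' m (b' n v) = b' n (b' m v).
Hypothesis ab : forall m n v, a m (b n v) = b n (a m v).
Hypothesis ab' : forall m n v, a m (b' n v) = b' n (a m v).
Hypothesis a'b : forall m n v, a' m (b n v) = b n (a' m v).
Hypothesis a'b' : forall m n v, a' m (b' n v) = b' n (a' m v).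
Hypothesis aa'C : forall m n v, a m (a' n v) = a' n (a m v).
Hypothesis bb'C : forall m n v, b m (b' n v) = b' n (b m v).

Lemma quadC ll rr lr rl ll' rr' lr' rl' v :
  quad ll rr lr rl (quad ll' rr' lr' rl' v)
    = quad ll' rr' lr' rl' (quad ll rr lr rl v).
Proof.
by apply: commute_quad => n {}v; symmetry; apply: commute_quad => m u;
  rewrite ?(aa m n, bb m n, aa' m n, bb' m n, ab, ab', a'b, a'b', aa'C, bb'C).
Qed.

Lemma divpow_quadD ll rr lr rl ll' rr' lr' rl' m v :
  divpow (quad (ll + ll') (rr + rr') (lr + lr') (rl + rl')) m v
    = \sum_(i < m.+1)
        divpow (quad ll rr lr rl) i (divpow (quad ll' rr' lr' rl') (m - i) v).
Proof.
rewrite -(divpowD (quadC _ _ _ _ _ _ _ _)); apply: eq_divpow => u.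
by rewrite quadD.
Qed.

(** Both sides are the divided power of the operator with coefficients
    - l, - l, 1, - 1: on the left the mixed terms in l cancel, and on the right
    this operator is split into the Moyal operator and the operators - D (x) 1
    and - 1 (x) D. *)
Lemma quad_exp_split (l : T -> K) m v :
  \sum_(i < m.+1) divpow (quad (- l) (- l) (- l) (- l)) i
      (divpow (quad 0 0 (1 + l) (l - 1)) (m - i) v)
  = \sum_(r < m.+1) \sum_(k < (m - r).+1) divpow (quad 0 0 1 (- 1)) r
      (divpow (quad (- l) 0 0 0) k (divpow (quad 0 (- l) 0 0) (m - r - k) v)).
Proof.
rewrite -divpow_quadD.
transitivity (divpow (quad (0 + - l) (0 + - l) (1 + 0) (- 1 + 0)) m v).
  by apply: eq_divpow => u; rewrite !addr0 !add0r addrCA addNr addr0 addrA addNr add0r.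
rewrite divpow_quadD; apply: eq_bigr => r _; rewrite -divpow_sum -divpow_quadD.
by congr divpow; apply: eq_divpow => u; rewrite !addr0 !add0r.
Qed.

End Quadratic.

(** * The intertwining identity for finitely many modes *)

Section Truncated.
Variables (R : realType) (A : seq mode).
Local Notation C := R[i].
Local Notation ser := (ser R).
Local Notation arr := (arr R).

Definition bidiff_trunc := quad A
  (fun n => annihl (R := R) (dirH n) : {linear arr -> arr}) (fun n => annihl (dirHdual n))
  (fun n => annihr (R := R) (dirH n)) (fun n => annihr (dirHdual n)).

Definition laplace_trunc (l : mode -> C) (F : ser) : ser :=
  \sum_(n <- A) l n *: sannih (dirH n) (sannih (dirHdual n) F).

(** The Leibniz rule, applied twice: the two mixed terms are the operator E. *)
Lemma laplace_trunc_wick l P :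
  laplace_trunc l (swick P) = swick (bidiff_trunc l l l l P).
Proof.
rewrite /laplace_trunc /bidiff_trunc /quad linear_sum; apply: eq_bigr => n _.
rewrite !annih_wick -!scalerDr linearZ /=; congr (_ *: swick _).
rewrite !linearD /= -annihlrC.
move: (annihl _ (annihl _ _)) (annihl _ (annihr _ _)) (annihl _ (annihr _ _)).
move: (annihr _ (annihr _ _)) => Pr Pll Plr Prl.
by rewrite [Plr + Pr]addrC addrA [Pll + Prl + Pr]addrAC.
Qed.

Lemma tensorDl F F' G : stensor (F + F') G = stensor F G + stensor F' G :> arr.
Proof. by apply/funext => I; apply/funext => J; exact: mulrDl. Qed.
Lemma tensorDr F G G' : stensor F (G + G') = stensor F G + stensor F G' :> arr.
Proof. by apply/funext => I; apply/funext => J; exact: mulrDr. Qed.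
Lemma tensorZl a F G : stensor (a *: F) G = a *: stensor F G :> arr.
Proof. by apply/funext => I; apply/funext => J; exact: esym (mulrA _ _ _). Qed.
Lemma tensorZr a F G : stensor F (a *: G) = a *: stensor F G :> arr.
Proof. by apply/funext => I; apply/funext => J; exact: mulrCA. Qed.
Lemma tensor0l G : stensor 0 G = 0 :> arr.
Proof. by apply/funext => I; apply/funext => J; exact: mul0r. Qed.
Lemma tensor0r F : stensor F 0 = 0 :> arr.
Proof. by apply/funext => I; apply/funext => J; exact: mulr0. Qed.

Lemma annihl_tensor x F G : annihl x (stensor F G) = stensor (sannih x F) G :> arr.
Proof. by apply/funext => I; apply/funext => J; exact: mulrA. Qed.
Lemma annihr_tensor x F G : annihr x (stensor F G) = stensor F (sannih x G) :> arr.
Proof. by apply/funext => I; apply/funext => J; exact: mulrCA. Qed.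

Lemma bidiff_trunc_tensorl l F G :
  bidiff_trunc l 0 0 0 (stensor F G) = stensor (laplace_trunc l F) G.
Proof.
rewrite /bidiff_trunc quad_ll /laplace_trunc.
elim: A => [|n B IH]; first by rewrite !big_nil tensor0l.
rewrite !big_cons {}IH tensorDl tensorZl.
by rewrite /= !annihl_tensor.
Qed.

Lemma bidiff_trunc_tensorr l F G :
  bidiff_trunc 0 l 0 0 (stensor F G) = stensor F (laplace_trunc l G).
Proof.
rewrite /bidiff_trunc quad_rr /laplace_trunc.
elim: A => [|n B IH]; first by rewrite !big_nil tensor0r.
rewrite !big_cons {}IH tensorDr tensorZr.
by rewrite /= !annihr_tensor.
Qed.

Lemma divpow_tensorl l m F G :
  divpow (bidiff_trunc l 0 0 0) m (stensor F G)
    = stensor (divpow (laplace_trunc l) m F) G.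
Proof.
rewrite /divpow.
have -> : iter m (bidiff_trunc l 0 0 0) (stensor F G)
    = stensor (iter m (laplace_trunc l) F) G.
  by elim: m => //= m ->; rewrite bidiff_trunc_tensorl.
by rewrite tensorZl.
Qed.

Lemma divpow_tensorr l m F G :
  divpow (bidiff_trunc 0 l 0 0) m (stensor F G)
    = stensor F (divpow (laplace_trunc l) m G).
Proof.
rewrite /divpow.
have -> : iter m (bidiff_trunc 0 l 0 0) (stensor F G)
    = stensor F (iter m (laplace_trunc l) G).
  by elim: m => //= m ->; rewrite bidiff_trunc_tensorr.
by rewrite tensorZr.
Qed.

Lemma truncated_intertwining (l : mode -> C) m F G :
  \sum_(i < m.+1) divpow (laplace_trunc (- l)) i
      (swick (divpow (bidiff_trunc 0 0 (1 + l) (l - 1)) (m - i) (stensor F G)))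
  = \sum_(r < m.+1) \sum_(k < (m - r).+1)
      swick (divpow (bidiff_trunc 0 0 1 (- 1)) r
        (stensor (divpow (laplace_trunc (- l)) k F)
                (divpow (laplace_trunc (- l)) (m - r - k) G))).
Proof.
transitivity (swick (\sum_(i < m.+1) divpow (bidiff_trunc (- l) (- l) (- l) (- l)) i
      (divpow (bidiff_trunc 0 0 (1 + l) (l - 1)) (m - i) (stensor F G)))).
  rewrite (linear_sum (swick (R := R))); apply: eq_bigr => i _.
  apply/esym/(@divpow_morph _ _ _ (swick (R := R) : {linear arr -> ser})) => u.
  by rewrite laplace_trunc_wick.
rewrite [X in swick X]quad_exp_split; try by move=> *; exact: annihlC.
- rewrite (linear_sum (swick (R := R))); apply: eq_bigr => r _.
  rewrite (linear_sum (swick (R := R))); apply: eq_bigr => k _.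
  by rewrite -divpow_tensorl -divpow_tensorr.
- by move=> *; exact: annihrC.
- by move=> *; exact: annihrC.
- by move=> *; exact: annihlrC.
- by move=> *; rewrite /= annihlrC.
- by move=> *; exact: annihrC.
- by move=> *; exact: annihlrC.
- by move=> *; exact: annihlrC.
Qed.

End Truncated.

(** * Complex numbers and unordered sums *)

Section ComplexNorm.
Variable R : realType.
Local Notation normc := ComplexField.Normc.normc.
Implicit Types z : R[i].

Lemma normc_ge0 z : 0 <= normc z.
Proof. by case: z => x y; exact: sqrtr_ge0. Qed.

Lemma normc_nat n : normc (n%:R : R[i]) = n%:R.
Proof. by rewrite normcMn ComplexField.Normc.normc1. Qed.

Lemma normc_real (x : R) : normc (x%:C%C) = `|x|.
Proof. by rewrite /= expr0n /= addr0 sqrtr_sqr. Qed.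

Lemma abs_Re_le z : `|complex.Re z| <= normc z.
Proof.
case: z => x y /=; rewrite -sqrtr_sqr ler_wsqrtr// lerDl; exact: sqr_ge0.
Qed.

Lemma abs_Im_le z : `|complex.Im z| <= normc z.
Proof.
case: z => x y /=; rewrite -sqrtr_sqr ler_wsqrtr// lerDr; exact: sqr_ge0.
Qed.

Lemma normc_le z : normc z <= `|complex.Re z| + `|complex.Im z|.
Proof.
case: z => x y /=; rewrite -[leRHS]ger0_norm ?addr_ge0// -sqrtr_sqr ler_wsqrtr//.
rewrite sqrrD !real_normK ?num_real// -addrA lerD2l lerDr.
by rewrite mulrn_wge0// mulr_ge0.
Qed.

Lemma normc_sum_le (T : Type) (s : seq T) (P : pred T) (f : T -> R[i]) :
  normc (\sum_(i <- s | P i) f i) <= \sum_(i <- s | P i) normc (f i).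
Proof.
elim/big_rec2: _ => [|i x y _ h]; first by rewrite ComplexField.Normc.normc0.
by rewrite (le_trans (le_normcD _ _))// lerD2l.
Qed.
End ComplexNorm.

Section UnorderedSum.
Variables (R : realType) (T : choiceType).
Implicit Types f g h w : T -> R.
Local Notation C := R[i].
Local Notation normc := ComplexField.Normc.normc.

Definition finite_total g := (\esum_(i in [set: T]) (g i)%:E < +oo)%E.
Definition usum g : R := fine (\esum_(i in [set: T]) (g i)%:E).

Lemma finite_totalS g h : (forall i, g i <= h i) ->
  finite_total h -> finite_total g.
Proof. by move=> gh; apply: le_lt_trans; apply: le_esum => i _; rewrite lee_fin. Qed.

Lemma usumK g : (forall i, 0 <= g i) -> finite_total g ->
  (\esum_(i in [set: T]) (g i)%:E = (usum g)%:E)%E.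
Proof.
move=> g0 gfin; rewrite /usum fineK// ge0_fin_numE//.
by apply: esum_ge0 => i _; rewrite lee_fin.
Qed.

Lemma usum_ge0 g : (forall i, 0 <= g i) -> 0 <= usum g.
Proof. by move=> g0; apply/fine_ge0/esum_ge0 => i _; rewrite lee_fin. Qed.

Lemma usum_le g h : (forall i, 0 <= g i <= h i) -> finite_total h ->
  usum g <= usum h.
Proof.
move=> gh hfin.
have g0 i : 0 <= g i by case/andP: (gh i).
have le_gh i : g i <= h i by case/andP: (gh i).
rewrite -lee_fin -!usumK//; first by apply: le_esum => i _; rewrite lee_fin.
- by move=> i; exact: le_trans (le_gh i).
- exact: finite_totalS hfin.
Qed.

Lemma esum_add g h : (forall i, 0 <= g i) -> (forall i, 0 <= h i) ->
  (\esum_(i in [set: T]) (g i + h i)%:E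
   = \esum_(i in [set: T]) (g i)%:E + \esum_(i in [set: T]) (h i)%:E)%E.
Proof.
move=> g0 h0; under eq_esum do rewrite EFinD.
by rewrite esumD// => i _; rewrite lee_fin.
Qed.

Lemma finite_totalD g h : (forall i, 0 <= g i) -> (forall i, 0 <= h i) ->
  finite_total g -> finite_total h -> finite_total (fun i => g i + h i).
Proof. by move=> *; rewrite /finite_total esum_add// lte_add_pinfty. Qed.

Lemma usumD g h : (forall i, 0 <= g i) -> (forall i, 0 <= h i) ->
  finite_total g -> finite_total h ->
  usum (fun i => g i + h i) = usum g + usum h.
Proof. by move=> *; rewrite {1}/usum esum_add// !usumK. Qed.

Lemma finite_totalZ k g : 0 <= k -> (forall i, 0 <= g i) ->
  finite_total g -> finite_total (fun i => k * g i).
Proof.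
move=> k0 g0 gfin; rewrite /finite_total.
under eq_esum do rewrite EFinM.
by apply: esumZ_lty => // i; rewrite lee_fin.
Qed.

Lemma usumZ k g : 0 <= k -> (forall i, 0 <= g i) -> finite_total g ->
  usum (fun i => k * g i) = k * usum g.
Proof.
have le a f : 0 <= a -> (forall i, 0 <= f i) -> finite_total f ->
    usum (fun i => a * f i) <= a * usum f.
  move=> a0 f0 ffin; rewrite -lee_fin -usumK; last 2 first.
  - by move=> i; rewrite mulr_ge0.
  - exact: finite_totalZ.
  apply: ge_ereal_sup => _ [A [finA _] <-].
  rewrite EFinM -usumK// fsbig_finite//=.
  under eq_bigr do rewrite EFinM.
  rewrite -ge0_sume_distrr; last by move=> i _; rewrite lee_fin.
  rewrite lee_wpmul2l ?lee_fin//; apply: esum_ge; exists A => //.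
  by rewrite fsbig_finite.
move=> k0 g0 gfin; apply/eqP; rewrite eq_le le//=.
have [<-|kN0] := eqVneq 0 k.
  by rewrite mul0r usum_ge0// => i; rewrite mul0r.
have {}kN0 : 0 < k by rewrite lt_neqAle kN0.
rewrite mulrC -ler_pdivlMr// mulrC.
rewrite [in leLHS](_ : g = (fun i => k^-1 * (k * g i))); last first.
  by apply/funext => i; rewrite mulKf ?gt_eqF.
apply: le; first by rewrite invr_ge0.
- by move=> i; rewrite mulr_ge0.
- exact: finite_totalZ.
Qed.

Lemma usum_finite (s : seq T) g : uniq s -> (forall i, 0 <= g i) ->
  (forall i, i \notin s -> g i = 0) -> usum g = \sum_(i <- s) g i.
Proof.
move=> us g0 gs; rewrite /usum.
have -> : \esum_(i in [set: T]) (g i)%:E = \esum_(i in [set` s]) (g i)%:E.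
  rewrite [RHS]esum_mkcond; apply: eq_esum => i _.
  by rewrite mem_setE; case: ifPn => // /gs ->.
rewrite esum_fset; last 2 first.
- exact: finite_seq.
- by move=> i _; rewrite lee_fin.
by rewrite -fsbig_seq// sumEFin.
Qed.

Lemma sum_le_usum (s : seq T) g : uniq s -> (forall i, 0 <= g i) ->
  finite_total g -> \sum_(i <- s) g i <= usum g.
Proof.
move=> us g0 gfin; rewrite -lee_fin -usumK//.
apply: esum_ge; exists [set` s]; first by split => //; exact: finite_seq.
by rewrite -fsbig_seq// sumEFin.
Qed.

(** The sum of an absolutely summable real family; the value has no meaning for
    other families. *)
Definition rsum f : R :=
  usum (fun i => Num.max (f i) 0) - usum (fun i => Num.max (- f i) 0).

Let pos_ge0 f i : 0 <= Num.max (f i) 0.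
Proof. by rewrite le_max lexx orbT. Qed.

Let pos_le f i : Num.max (f i) 0 <= `|f i|.
Proof. by rewrite ge_max ler_norm normr_ge0. Qed.

Let finite_pos f : finite_total (fun i => `|f i|) ->
  finite_total (fun i => Num.max (f i) 0).
Proof. exact/finite_totalS/pos_le. Qed.

Let finite_neg f : finite_total (fun i => `|f i|) ->
  finite_total (fun i => Num.max (- f i) 0).
Proof.
by apply: finite_totalS => i; rewrite (le_trans (pos_le (fun i => - f i) i))// normrN.
Qed.

Let max_subN (x : R) : Num.max x 0 - Num.max (- x) 0 = x.
Proof.
by have [x0|x0] := leP 0 x; have [y0|y0] := leP 0 (- x); lra.
Qed.

(** Any decomposition as a difference of two nonnegative summable families gives
    the same value; additivity and homogeneity follow from that. *)
Lemma rsum_diff g h : (forall i, 0 <= g i) -> (forall i, 0 <= h i) ->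
  finite_total g -> finite_total h ->
  rsum (fun i => g i - h i) = usum g - usum h.
Proof.
move=> g0 h0 gfin hfin; rewrite /rsum; set f := fun i => g i - h i.
have ffin : finite_total (fun i => `|f i|).
  apply: finite_totalS (finite_totalD g0 h0 gfin hfin) => i.
  by rewrite (le_trans (ler_normB _ _))// !ger0_norm.
have : usum (fun i => Num.max (f i) 0 + h i)
    = usum (fun i => Num.max (- f i) 0 + g i).
  congr usum; apply/funext => i.
  by have := max_subN (f i); rewrite {3}/f => ?; lra.
have fpos := finite_pos ffin; have fneg := finite_neg ffin.
have n0 i : 0 <= Num.max (- f i) 0 by exact: (pos_ge0 (fun i => - f i)).
by rewrite !usumD//; lra.
Qed.

Let posE f : f = (fun i => Num.max (f i) 0 - Num.max (- f i) 0).
Proof. by apply/funext => i; rewrite max_subN. Qed.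

Lemma rsumD f g : finite_total (fun i => `|f i|) ->
  finite_total (fun i => `|g i|) ->
  rsum (fun i => f i + g i) = rsum f + rsum g.
Proof.
move=> ffin gfin.
have -> : (fun i => f i + g i) = (fun i =>
    (Num.max (f i) 0 + Num.max (g i) 0) - (Num.max (- f i) 0 + Num.max (- g i) 0)).
  by apply/funext => i; have := max_subN (f i); have := max_subN (g i); lra.
have n0 (k : T -> R) i : 0 <= Num.max (- k i) 0 by exact: (pos_ge0 (fun i => - k i)).
have [Pf Nf] := (finite_pos ffin, finite_neg ffin).
have [Pg Ng] := (finite_pos gfin, finite_neg gfin).
rewrite rsum_diff ?usumD//; first by rewrite /rsum; ring.
- by move=> i; rewrite addr_ge0.
- by move=> i; rewrite addr_ge0.
- exact: finite_totalD.
- exact: finite_totalD.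
Qed.

Lemma rsumZ a f : finite_total (fun i => `|f i|) ->
  rsum (fun i => a * f i) = a * rsum f.
Proof.
move=> ffin.
have n0 (k : T -> R) i : 0 <= Num.max (- k i) 0 by exact: (pos_ge0 (fun i => - k i)).
have [Pf Nf] := (finite_pos ffin, finite_neg ffin).
have [a0|/ltW a0] := leP 0 a.
  have -> : (fun i => a * f i)
      = (fun i => a * Num.max (f i) 0 - a * Num.max (- f i) 0).
    by apply/funext => i; have {1}<- := max_subN (f i); ring.
  rewrite rsum_diff ?usumZ//; first by rewrite /rsum; ring.
  - by move=> i; rewrite mulr_ge0.
  - by move=> i; rewrite mulr_ge0.
  - exact: finite_totalZ.
  - exact: finite_totalZ.
have Na0 : 0 <= - a by rewrite oppr_ge0.
have -> : (fun i => a * f i)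
    = (fun i => (- a) * Num.max (- f i) 0 - (- a) * Num.max (f i) 0).
  by apply/funext => i; have {1}<- := max_subN (f i); ring.
rewrite rsum_diff ?usumZ//; first by rewrite /rsum; ring.
- by move=> i; rewrite mulr_ge0.
- by move=> i; rewrite mulr_ge0.
- exact: finite_totalZ.
- exact: finite_totalZ.
Qed.

Lemma rsum_le f : finite_total (fun i => `|f i|) ->
  `|rsum f| <= usum (fun i => `|f i|).
Proof.
move=> ffin; rewrite /rsum.
have n0 (k : T -> R) i : 0 <= Num.max (- k i) 0 by exact: (pos_ge0 (fun i => - k i)).
have P0 : 0 <= usum (fun i => Num.max (f i) 0) by exact: usum_ge0.
have N0 : 0 <= usum (fun i => Num.max (- f i) 0) by exact: usum_ge0.
have P1 : usum (fun i => Num.max (f i) 0) <= usum (fun i => `|f i|).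
  by apply: usum_le => // i; rewrite pos_ge0 pos_le.
have N1 : usum (fun i => Num.max (- f i) 0) <= usum (fun i => `|f i|).
  by apply: usum_le => // i; rewrite n0 -normrN (pos_le (fun i => - f i)).
by rewrite ler_norml; lra.
Qed.

Lemma rsum_finite (s : seq T) f : uniq s -> (forall i, i \notin s -> f i = 0) ->
  rsum f = \sum_(i <- s) f i.
Proof.
move=> us fs; rewrite /rsum !(usum_finite us) -?sumrB.
- by apply: eq_bigr => i _; rewrite [in RHS](posE f).
- by move=> i; exact: (pos_ge0 (fun i => - f i)).
- by move=> i /fs ->; rewrite oppr0 maxxx.
- by move=> i; exact: pos_ge0.
- by move=> i /fs ->; rewrite maxxx.
Qed.

Definition csum (f : T -> C) : C :=
  Complex (rsum (fun i => complex.Re (f i))) (rsum (fun i => complex.Im (f i))).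

Lemma csum_finite (s : seq T) (f : T -> C) : uniq s ->
  (forall i, i \notin s -> f i = 0) -> csum f = \sum_(i <- s) f i.
Proof.
move=> us fs; rewrite /csum !(rsum_finite us); last 2 first.
- by move=> i /fs ->.
- by move=> i /fs ->.
elim: s {us fs} => [|i s]; first by rewrite !big_nil.
by rewrite !big_cons => <-; case: (f i).
Qed.

(* Absolute convergence always comes from domination by a multiple of one fixed
   summable family. *)
Section Dominated.
Variables (w : T -> R).
Hypotheses (w0 : forall i, 0 <= w i) (wfin : finite_total w).

Let Mw M : finite_total (fun i => M * w i).
Proof.
apply: (@finite_totalS _ (fun i => `|M| * w i)); last exact: finite_totalZ.
by move=> i; rewrite ler_wpM2r// ler_norm.
Qed.

(** The factor 2 comes from the separate estimates of the real and the imaginary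
    part. *)
Lemma csum_le M (f : T -> C) : (forall i, normc (f i) <= M * w i) ->
  normc (csum f) <= 2 * usum w * M.
Proof.
move=> fM; have [i0|noT] := pselect (exists i : T, True); last first.
  rewrite (@csum_finite [::])// ?big_nil ?ComplexField.Normc.normc0.
    suff -> : usum w = 0 by rewrite mulr0 mul0r.
    by rewrite (@usum_finite [::])// ?big_nil// => i; case: noT; exists i.
  by move=> i; case: noT; exists i.
have Rfin : finite_total (fun i => `|complex.Re (f i)|).
  by apply: finite_totalS (Mw M) => i; exact: le_trans (abs_Re_le _) (fM i).
have Ifin : finite_total (fun i => `|complex.Im (f i)|).
  by apply: finite_totalS (Mw M) => i; exact: le_trans (abs_Im_le _) (fM i).
apply: le_trans (normc_le _) _ => /=.
have tM : usum (fun i => M * w i) <= usum w * M.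
  have [M0|M0] := leP 0 M; first by rewrite usumZ// mulrC.
  have z i : w i = 0.
    apply/eqP; rewrite eq_le w0 andbT.
    have := le_trans (normc_ge0 _) (fM i); rewrite nmulr_rge0//.
  rewrite !(@usum_finite [::])// ?big_nil ?mul0r// => i; rewrite z ?mulr0//.
have Rle := rsum_le Rfin; have Ile := rsum_le Ifin.
have : usum (fun i => `|complex.Re (f i)|) <= usum (fun i => M * w i).
  by apply: usum_le => // i; rewrite normr_ge0 (le_trans (abs_Re_le _)).
have : usum (fun i => `|complex.Im (f i)|) <= usum (fun i => M * w i).
  by apply: usum_le => // i; rewrite normr_ge0 (le_trans (abs_Im_le _)).
lra.
Qed.

Lemma csum_linear M N a (f g : T -> C) : (forall i, normc (f i) <= M * w i) ->
  (forall i, normc (g i) <= N * w i) ->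
  csum (fun i => a * f i + g i) = a * csum f + csum g.
Proof.
move=> fM gN.
have Rf : finite_total (fun i => `|complex.Re (f i)|).
  by apply: finite_totalS (Mw M) => i; exact: le_trans (abs_Re_le _) (fM i).
have If : finite_total (fun i => `|complex.Im (f i)|).
  by apply: finite_totalS (Mw M) => i; exact: le_trans (abs_Im_le _) (fM i).
have Rg : finite_total (fun i => `|complex.Re (g i)|).
  by apply: finite_totalS (Mw N) => i; exact: le_trans (abs_Re_le _) (gN i).
have Ig : finite_total (fun i => `|complex.Im (g i)|).
  by apply: finite_totalS (Mw N) => i; exact: le_trans (abs_Im_le _) (gN i).
have Z k (u : T -> R) : finite_total (fun i => `|u i|) ->
    finite_total (fun i => `|k * u i|).
  move=> ufin; apply: finite_totalS (@finite_totalZ `|k| _ _ _ ufin) => // i.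
  by rewrite normrM.
have DD (u v : T -> R) : finite_total (fun i => `|u i|) ->
    finite_total (fun i => `|v i|) -> finite_total (fun i => `|u i + v i|).
  move=> ufin vfin; apply: finite_totalS (finite_totalD _ _ ufin vfin) => // i.
  exact: ler_normD.
have lin x y (u v t : T -> R) : finite_total (fun i => `|u i|) ->
    finite_total (fun i => `|v i|) -> finite_total (fun i => `|t i|) ->
    rsum (fun i => x * u i + y * v i + t i) = x * rsum u + y * rsum v + rsum t.
  move=> ufin vfin tfin; have xufin := Z x _ ufin; have yvfin := Z y _ vfin.
  rewrite rsumD//; last exact: (DD (fun i => x * u i) (fun i => y * v i)).
  by rewrite rsumD// !rsumZ.
case: a => x y; rewrite /csum.
have -> : (fun i => complex.Re (Complex x y * f i + g i)) = (fun i =>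
    (x * complex.Re (f i) + (- y) * complex.Im (f i)) + complex.Re (g i)).
  by apply/funext => i; case: (f i) (g i) => [p q] [r s] /=; ring.
have -> : (fun i => complex.Im (Complex x y * f i + g i)) = (fun i =>
    (x * complex.Im (f i) + y * complex.Re (f i)) + complex.Im (g i)).
  by apply/funext => i; case: (f i) (g i) => [p q] [r s] /=; ring.
rewrite !lin//; apply/eqP; rewrite eq_complex /=; apply/andP; split; apply/eqP; ring.
Qed.
End Dominated.
End UnorderedSum.

(** * Weights and nuclearity *)

Lemma ler_sum_subset (R : numDomainType) (T : eqType) (s t : seq T) (f : T -> R) :
  uniq s -> uniq t -> {subset s <= t} -> (forall i, 0 <= f i) ->
  \sum_(i <- s) f i <= \sum_(i <- t) f i.
Proof.
move=> us ut st f0.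
rewrite (perm_big [seq i <- t | i \in s]); last first.
  apply: uniq_perm => //; first exact: filter_uniq.
  by move=> i; rewrite mem_filter andb_idr// => /st.
rewrite big_filter big_mkcond; apply: ler_sum => i _.
by case: ifP.
Qed.

(** The partial sums telescope: 1 / k^2 <= 1 / (k - 1) - 1 / k. *)
Lemma sum_inv_sqr_le2 (R : realFieldType) (s : seq nat) : uniq s ->
  (forall k, k \in s -> (0 < k)%N) -> \sum_(k <- s) (k%:R ^+ 2)^-1 <= 2 :> R.
Proof.
move=> us s0.
have h N : \sum_(1 <= k < N.+2) (k%:R ^+ 2)^-1 <= 2 - (N.+1%:R)^-1 :> R.
  elim: N => [|N IH].
    by rewrite big_nat1 expr1n invr1; lra.
  rewrite big_nat_recr//=; apply: le_trans (lerD IH (lexx _)) _.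
  have n0 : 0 < N.+1%:R :> R by rewrite ltr0n.
  rewrite -subr_ge0 (_ : _ - _ = (N.+2%:R ^+ 2 * N.+1%:R)^-1).
    by rewrite invr_ge0 mulr_ge0.
  rewrite -[N.+2%:R]natr1; move: N.+1%:R n0 => x x0.
  by field; rewrite !gt_eqF// addr_gt0.
apply: (@le_trans _ _ (\sum_(1 <= k < (\max_(k <- s) k).+2) (k%:R ^+ 2)^-1)).
  apply: ler_sum_subset => //.
  - exact: iota_uniq.
  - move=> k ks; rewrite mem_index_iota s0//= ltnS (@leq_trans (\max_(k <- s) k))//.
    exact: leq_bigmax_seq.
by apply: le_trans (h _) _; rewrite gerBl invr_ge0.
Qed.

Section Weights.
Variables (R : realType) (C1 : R).
Hypothesis C1_gt0 : 0 < C1.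

(** This weight replaces the square root of C1 n^2 + 1.  Being at least 2, its
    powers absorb the constants C^|I| of the norms and the multiplicities; being
    the square, it has polynomial size without roots. *)
Definition mweight (n : mode) : R := 2 * (C1 * (val n)%:~R ^+ 2 + 1).
Definition weight (I : multiindex) : R := \prod_(x <- enum_mset I) mweight x.1.

Lemma mweight_ge2 n : 2 <= mweight n.
Proof.
have : 0 <= C1 * (val n)%:~R ^+ 2 by rewrite mulr_ge0 ?sqr_ge0// ltW.
rewrite /mweight; lra.
Qed.

Lemma mweight_gt0 n : 0 < mweight n.
Proof. by rewrite (lt_le_trans _ (mweight_ge2 n)). Qed.

Lemma mweight_ge1 n : 1 <= mweight n.
Proof. by rewrite (le_trans _ (mweight_ge2 n))// ler1n. Qed.

Lemma perm_enum_mset1D (x : idx) (I : multiindex) :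
  perm_eq (enum_mset (x +` I)%mset) (x :: enum_mset I).
Proof.
rewrite /perm_eq; apply/allP => y _; apply/eqP.
by rewrite count_mem_mset mset1DE [RHS]/= count_mem_mset eq_sym.
Qed.

Lemma weight0 : weight mset0 = 1.
Proof. by rewrite /weight enum_mset0 big_nil. Qed.

Lemma weight1D x I : weight (x +` I)%mset = mweight x.1 * weight I.
Proof. by rewrite /weight (perm_big _ (perm_enum_mset1D x I)) big_cons. Qed.

Lemma weightD I J : weight (I `+` J)%mset = weight I * weight J.
Proof.
elim/mset_ind: I => [|x I IH]; first by rewrite mset0D weight0 mul1r.
by rewrite -msetDA !weight1D IH mulrA.
Qed.

Lemma weight_ge1 I : 1 <= weight I.
Proof.
elim/mset_ind: I => [|x I IH]; first by rewrite weight0.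
by rewrite weight1D mulr_ege1// mweight_ge1.
Qed.

Lemma weight_gt0 I : 0 < weight I.
Proof. by rewrite (lt_le_trans _ (weight_ge1 I)). Qed.

(** A multiplicity is at most |I|, thus less than 2^|I|, and 2^|I| is at most the
    weight. *)
Lemma mult_le_weight (I : multiindex) (x : idx) : (I x)%:R <= weight I.
Proof.
elim/mset_ind: I => [|y I IH]; first by rewrite mset0E weight0.
rewrite weight1D mset1DE natrD.
have h1 := weight_ge1 I; have h2 := mweight_ge2 y.1.
have h3 : 2 * weight I <= mweight y.1 * weight I.
  by rewrite ler_wpM2r// ltW// weight_gt0.
have h4 : (x == y)%:R <= 1 :> R by case: (x == y); rewrite ?ler01.
lra.
Qed.

Lemma absz_le_mweight : exists2 K : R, 1 <= K &
  forall n : mode, (`|val n|%N)%:R <= K * mweight n.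
Proof.
exists (1 + C1^-1); first by rewrite lerDl invr_ge0 ltW.
move=> n; set a : R := (`|val n|%N)%:R.
have -> : mweight n = 2 * (C1 * a ^+ 2 + 1).
  by rewrite /mweight /a natr_absz intr_norm real_normK// num_real.
have a1 : 1 <= a.
  by rewrite /a ler1n absz_gt0 (valP n).
have aa : a <= a ^+ 2 by rewrite expr2 ler_peMl// (le_trans _ a1).
have -> : (1 + C1^-1) * (2 * (C1 * a ^+ 2 + 1))
   = 2 * a ^+ 2 + (2 * (C1 * a ^+ 2) + 2 + 2 * C1^-1).
  by field; rewrite gt_eqF.
have : 0 <= C1 * a ^+ 2 by rewrite mulr_ge0 ?sqr_ge0// ltW.
have : 0 <= C1^-1 by rewrite invr_ge0 ltW.
lra.
Qed.

(** The weight grows at least linearly in n, so that polynomial growth in n is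
    growth bounded by a power of the weight. *)
Lemma growth_le_mweight (lambda : mode -> R) :
  (exists C alpha : R, forall n : mode,
     `|lambda n| <= C * (`|val n|%N%:R) `^ alpha) ->
  exists L a, [/\ 0 <= L & forall n, `|lambda n| <= L * mweight n ^+ a].
Proof.
move=> [C [alpha h]]; have [K K1 hK] := absz_le_mweight.
pose a := (Num.truncn `|alpha|).+1.
exists (`|C| * K ^+ a), a; split.
  by rewrite mulr_ge0// exprn_ge0// (le_trans _ K1).
move=> n; apply: le_trans (h n) _.
have n1 : 1 <= (`|val n|%N)%:R :> R by rewrite ler1n absz_gt0 (valP n).
apply: (@le_trans _ _ (`|C| * (`|val n|%N)%:R `^ alpha)).
  by rewrite ler_wpM2r ?powR_ge0// ler_norm.
rewrite -mulrA -exprMn ler_wpM2l//.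
apply: (@le_trans _ _ ((`|val n|%N)%:R `^ a%:R)).
  rewrite ler_powR//; apply: (le_trans (ler_norm _)).
  exact/ltW/truncnS_gt.
rewrite powR_mulrn ?ler0n// lerXn2r// nnegrE ?ler0n// mulr_ge0//.
  by rewrite (le_trans _ K1).
exact/ltW/mweight_gt0.
Qed.

(** A nonzero integer is given by its sign and its absolute value, so that the sum
    is at most twice the sum of 1 / (2 C1 k^2) over the positive integers k. *)
Lemma finite_total_mode : finite_total (fun n : mode => (mweight n)^-1).
Proof.
have h (s : seq mode) : uniq s ->
    \sum_(n <- s) (mweight n)^-1 <= (2 * C1)^-1 * 4.
  move=> us.
  have le n : (mweight n)^-1 <= (2 * C1)^-1 * ((`|val n|%N)%:R ^+ 2)^-1.
    have n1 : 1 <= (`|val n|%N)%:R :> R by rewrite ler1n absz_gt0 (valP n).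
    have -> : mweight n = 2 * C1 * (`|val n|%N)%:R ^+ 2 + 2.
      rewrite /mweight natr_absz intr_norm real_normK ?num_real//; ring.
    have n0 : 0 < 2 * C1 * (`|val n|%N)%:R ^+ 2.
      by rewrite !mulr_gt0// (lt_le_trans _ n1).
    by rewrite -invfM lef_pV2 ?posrE ?lerDl// addr_gt0.
  apply: le_trans (ler_sum _ (fun n _ => le n)) _.
  rewrite -mulr_sumr ler_wpM2l ?invr_ge0 ?mulr_ge0 ?(ltW C1_gt0)//.
  have half b : \sum_(n <- s | (0 <= val n) == b) ((`|val n|%N)%:R ^+ 2)^-1 <= 2 :> R.
    rewrite -big_filter -(big_map (fun n : mode => `|val n|%N) xpredT
      (fun k => (k%:R ^+ 2)^-1)).
    apply: sum_inv_sqr_le2; last first.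
      by move=> k /mapP[n _ ->]; rewrite absz_gt0 (valP n).
    rewrite map_inj_in_uniq ?filter_uniq// => m n.
    rewrite !mem_filter => /andP[/eqP mb _] /andP[/eqP nb _] mn; apply: val_inj.
    move: mb nb mn; case: (val m) (val n) => [i|i] [j|j] /=; case: b => //= _ _.
      by move=> ->.
    by case=> ->.
  rewrite (bigID (fun n : mode => 0 <= val n)) /=.
  have -> : 4 = 2 + 2 :> R by ring.
  apply: lerD.
    by apply: le_trans (half true); rewrite le_eqVlt; apply/orP; left; apply/eqP;
      apply: eq_bigl => n; rewrite eqb_id.
  by apply: le_trans (half false); rewrite le_eqVlt; apply/orP; left; apply/eqP;
    apply: eq_bigl => n; rewrite eqbF_neg.
apply: (@le_lt_trans _ _ ((2 * C1)^-1 * 4)%:E); last exact: ltry.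
apply: ge_ereal_sup => _ [A [finA _] <-].
by rewrite fsbig_finite//= sumEFin lee_fin h// fset_uniq.
Qed.

(** For large k the sum s of the values 1 / mweight^k over all indices is at most
    1/2.  Let e_m be the sum of the inverse weights over multiindices of size at
    most m.  A nonempty multiindex of size at most m + 1 is an index plus a
    multiindex of size at most m, so that e_(m+1) <= 1 + s e_m, and e_m <= 2 for
    all m by induction. *)
Lemma nuclear : exists k, finite_total (fun I => (weight I ^+ k)^-1).
Proof.
have [Z Z0 hZ] : exists2 Z, 0 <= Z & forall s : seq mode, uniq s ->
    \sum_(n <- s) (mweight n)^-1 <= Z.
  have w0 n : 0 <= (mweight n)^-1 by rewrite invr_ge0 ltW// mweight_gt0.
  exists (usum (fun n => (mweight n)^-1)); first exact: usum_ge0.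
  by move=> s us; apply: sum_le_usum => //; exact: finite_total_mode.
pose k := (Num.truncn (4 * Z)).+1.
(* Each mode occurs in two directions, and mweight^(k+1) >= 2^k mweight. *)
have kZ : 4 * Z <= 2 ^+ k.
  apply: ltW; apply: (lt_le_trans (truncnS_gt _)).
  by rewrite -natrX ler_nat ltnW// ltn_expl.
exists k.+1; pose a (x : idx) := (mweight x.1 ^+ k.+1)^-1.
have a0 x : 0 <= a x by rewrite invr_ge0 exprn_ge0// ltW// mweight_gt0.
have W0 I : 0 <= (weight I ^+ k.+1)^-1.
  by rewrite invr_ge0 exprn_ge0// ltW// weight_gt0.
have ha (s : seq idx) : uniq s -> \sum_(x <- s) a x <= 2^-1.
  move=> us.
  pose t := undup [seq x.1 | x <- s].
  apply: (@le_trans _ _ (\sum_(x <- [seq (n, b) | n <- t, b <- [:: true; false]]) a x)).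
    apply: ler_sum_subset => //.
      by apply: allpairs_uniq => //; [exact: undup_uniq|case=> ? ? [? ?] _ _ [-> ->]].
    move=> [n b] xs; apply/allpairsP; exists (n, b); split => //.
      by rewrite mem_undup; apply/mapP; exists (n, b).
    by case: b {xs}.
  rewrite big_allpairs.
  apply: (@le_trans _ _ (\sum_(n <- t) 2 * ((2 ^+ k)^-1 * (mweight n)^-1))).
    apply: ler_sum => n _; rewrite !big_cons big_nil /= addr0 /a /=.
    have dbl (u : R) : u + u = 2 * u by ring.
    rewrite dbl ler_wpM2l// -invfM lef_pV2 ?posrE.
    - rewrite exprSr ler_wpM2r ?(ltW (mweight_gt0 n))//.
      by rewrite lerXn2r ?nnegrE ?(ltW (mweight_gt0 n))// mweight_ge2.
    - by rewrite exprn_gt0// mweight_gt0.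
    - by rewrite mulr_gt0 ?exprn_gt0// mweight_gt0.
  rewrite -!mulr_sumr.
  have := hZ t (undup_uniq _).
  set S := \sum_(n <- t) _ => SZ.
  have p2 : 0 < 2 ^+ k :> R by rewrite exprn_gt0.
  rewrite mulrCA ler_pdivrMl// ; lra.
have hW m (s : seq multiindex) : uniq s ->
    (forall I, I \in s -> (size (enum_mset I) <= m)%N) ->
    \sum_(I <- s) (weight I ^+ k.+1)^-1 <= 2.
  elim: m s => [|m IH] s us sm.
    apply: le_trans (_ : \sum_(I <- [:: mset0]) (weight I ^+ k.+1)^-1 <= 2).
      apply: ler_sum_subset => // I /sm; rewrite leqn0 size_eq0 => /eqP I0.
      by rewrite inE -(seq_mset_id I) I0; apply/eqP/msetP => y; rewrite mset_seqE mset0E.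
    by rewrite big_seq1 weight0 expr1n invr1 ler1n.
  (* Removing one chosen element is injective on nonempty multiindices. *)
  have [hd [tl hdK]] : exists (hd : multiindex -> idx) (tl : multiindex -> multiindex),
      forall I, I != mset0 -> (hd I +` tl I)%mset = I.
    pose d : idx := (exist _ (1 : int) isT, false).
    exists (fun I => head d (enum_mset I)).
    exists (fun I => (I `\ head d (enum_mset I))%mset) => I I0.
    rewrite msetB1K// in_mset -count_mem_mset -has_count has_pred1.
    case E : (enum_mset I) => [|x l]; last by rewrite mem_head.
    case/eqP: I0; rewrite -(seq_mset_id I) E; apply/msetP => y.
    by rewrite mset_seqE mset0E.
  pose s' : seq multiindex := [seq I <- s | I != mset0].
  pose X := undup [seq hd L | L <- s']; pose Y : seq multiindex := undup [seq tl L | L <- s'].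
  have -> : 2 = 1 + 2^-1 * 2 :> R by field.
  rewrite (bigID (fun I => I == mset0)) /=; apply: lerD.
    rewrite -big_filter.
    apply: le_trans (_ : \sum_(I <- [:: mset0]) (weight I ^+ k.+1)^-1 <= 1).
      apply: ler_sum_subset => //; first exact: filter_uniq.
      by move=> I; rewrite mem_filter inE => /andP[].
    by rewrite big_seq1 weight0 expr1n invr1.
  rewrite -big_filter -/s'.
  apply: (@le_trans _ _ (\sum_(p <- [seq (x, J) | x <- X, J <- Y])
      a p.1 * (weight p.2 ^+ k.+1)^-1)).
    have -> : \sum_(I <- s') (weight I ^+ k.+1)^-1
        = \sum_(p <- [seq (hd L, tl L) | L <- s']) a p.1 * (weight p.2 ^+ k.+1)^-1.
      rewrite big_map big_seq [RHS]big_seq; apply: eq_bigr => I.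
      rewrite mem_filter => /andP[I0 _] /=.
      by rewrite -{1}(hdK I I0) weight1D exprMn invfM.
    apply: ler_sum_subset.
    - rewrite map_inj_in_uniq; first exact: filter_uniq.
      move=> I J; rewrite mem_filter => /andP[I0 _]; rewrite mem_filter => /andP[J0 _].
      case=> hIJ tIJ.
      by rewrite -(hdK I I0) -(hdK J J0) hIJ tIJ.
    - by apply: allpairs_uniq; rewrite ?undup_uniq// => -[? ?] [? ?] _ _ [-> ->].
    - move=> _ /mapP[I Is ->]; apply/allpairsP; exists (hd I, tl I).
      by split => //=; rewrite mem_undup; apply/mapP; exists I.
    - by move=> p; rewrite mulr_ge0.
  rewrite big_allpairs /=; under eq_bigr do rewrite -mulr_sumr.
  rewrite -mulr_suml ler_pM ?sumr_ge0//; first by rewrite ha// undup_uniq.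
  apply: IH; first exact: undup_uniq.
  move=> J; rewrite mem_undup => /mapP[I]; rewrite mem_filter => /andP[I0 Is] ->.
  have := sm I Is; rewrite -{1}(hdK I I0).
  by rewrite (perm_size (perm_enum_mset1D _ _)).
apply: (@le_lt_trans _ _ 2%:E); last exact: ltry.
apply: ge_ereal_sup => _ [A [finA _] <-].
rewrite fsbig_finite//= sumEFin lee_fin.
apply: (hW (\max_(I <- fset_set A) size (enum_mset I))).
  exact: fset_uniq.
by move=> I IA; exact: leq_bigmax_seq.
Qed.

End Weights.

(** * Families of rapid decay *)

Section RapidDecay.
Variables (R : realType) (C1 : R).
Hypothesis C1_gt0 : 0 < C1.
Local Notation C := R[i].
Local Notation normc := ComplexField.Normc.normc.
Local Notation ser := (ser R).
Local Notation arr := (arr R).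
Local Notation mweight := (mweight C1).
Local Notation weight := (weight C1).

Definition decay k M (F : ser) := forall I, normc (F I) * weight I ^+ k <= M.
Definition decay2 k M (P : arr) :=
  forall I J, normc (P I J) * (weight I * weight J) ^+ k <= M.

Definition rapid (F : ser) := forall k, exists M, decay k M F.
Definition rapid2 (P : arr) := forall k, exists M, decay2 k M P.

Lemma decay_ge0 k M F : decay k M F -> 0 <= M.
Proof.
by move=> /(_ mset0); apply: le_trans; rewrite weight0 expr1n mulr1 normc_ge0.
Qed.

Lemma decay2_ge0 k M P : decay2 k M P -> 0 <= M.
Proof.
by move=> /(_ mset0 mset0); apply: le_trans; rewrite weight0 mulr1 expr1n mulr1 normc_ge0.
Qed.

Let w0 I : 0 <= weight I. Proof. exact/ltW/weight_gt0. Qed.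
Let q0 n : 0 <= mweight n. Proof. exact/ltW/mweight_gt0. Qed.

Lemma decayW k k' M M' F : (k' <= k)%N -> M <= M' -> decay k M F -> decay k' M' F.
Proof.
move=> kk MM FM I; apply: le_trans (le_trans (FM I) MM).
by rewrite ler_wpM2l ?normc_ge0// ler_weXn2l// weight_ge1.
Qed.

Lemma decay_linear k M N a F G : decay k M F -> decay k N G ->
  decay k (normc a * M + N) (a *: F + G).
Proof.
move=> FM GN I; rewrite serD serZ.
apply: le_trans (_ : (normc a * normc (F I) + normc (G I)) * weight I ^+ k <= _).
  rewrite ler_wpM2r ?exprn_ge0// -ComplexField.Normc.normcM; exact: le_normcD.
by rewrite mulrDl lerD// -mulrA ler_wpM2l ?normc_ge0.
Qed.

Lemma decay_tensor k M N F G : decay k M F -> decay k N G ->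
  decay2 k (M * N) (stensor F G).
Proof.
move=> FM GN I J; rewrite ComplexField.Normc.normcM exprMn mulrACA.
by rewrite ler_pM ?mulr_ge0 ?normc_ge0 ?exprn_ge0.
Qed.

Lemma rapid_tensor F G : rapid F -> rapid G -> rapid2 (stensor F G).
Proof.
move=> rF rG k; have [M FM] := rF k; have [N GN] := rG k.
by eexists; exact: decay_tensor FM GN.
Qed.

(** The splittings of I are determined by their first parts; so the loss of k0
    powers of the weight makes their sum converge, uniformly in I. *)
Lemma decay_wick : exists k0 S, 0 <= S /\
  forall k M P, decay2 (k + k0) M P -> decay k (S * M) (swick P).
Proof.
have [k0 hk0] := nuclear C1_gt0; exists k0.
have W0 I : 0 <= (weight I ^+ k0)^-1 by rewrite invr_ge0 exprn_ge0.
exists (usum (fun I => (weight I ^+ k0)^-1)); split; first exact: usum_ge0.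
move=> k M P PM I; have M0 := decay2_ge0 PM.
rewrite wickE; set s := fset_set (splits I).
have sI p : p \in s -> (p.1 `+` p.2)%mset = I.
  by rewrite in_fset_set ?inE//; exact: finite_splits.
apply: (@le_trans _ _ (\sum_(p <- s) (weight p.1 ^+ k0)^-1 * M)).
  apply: le_trans (_ : \sum_(p <- s) (normc (P p.1 p.2) * weight I ^+ k) <= _).
    by rewrite -mulr_suml ler_wpM2r ?exprn_ge0//; exact: normc_sum_le.
  rewrite big_seq [leRHS]big_seq; apply: ler_sum => p /sI <-.
  rewrite weightD ler_pdivlMl ?exprn_gt0 ?weight_gt0// mulrCA.
  apply: le_trans (PM p.1 p.2); rewrite ler_wpM2l ?normc_ge0//.
  rewrite mulrC exprD ler_wpM2l ?exprn_ge0 ?mulr_ge0//.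
  by rewrite lerXn2r ?nnegrE ?mulr_ge0// ler_peMr// weight_ge1.
rewrite -mulr_suml ler_wpM2r//.
rewrite -(big_map (fun p : multiindex * multiindex => p.1) xpredT
  (fun I => (weight I ^+ k0)^-1)).
apply: sum_le_usum => //.
rewrite map_inj_in_uniq; first exact: fset_uniq.
move=> [p1 p2] [q1 q2] /sI /= pI /sI /= qI pq; rewrite -pq in qI *.
by congr (_, _); rewrite -(msetDKB p1 p2) pI -qI msetDKB.
Qed.

Lemma rapid_wick P : rapid2 P -> rapid (swick P).
Proof.
have [k0 [S [_ h]]] := decay_wick.
by move=> rP k; have [M PM] := rP (k + k0)%N; eexists; exact: h PM.
Qed.

Lemma succ_mult_le_weight (I : multiindex) x :
  (I x).+1%:R <= weight (x +` I)%mset.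
Proof. by have := mult_le_weight C1_gt0 (x +` I)%mset x; rewrite mset1DE eqxx. Qed.

Let ler_mul5 (i j p A B u A' B' : R) : 0 <= i -> 0 <= j -> 0 <= p ->
  0 <= A -> 0 <= B -> i * j <= u -> A <= A' -> B <= B' ->
  i * (j * p) * (A * B) <= p * (u * (A' * B')).
Proof.
move=> i0 j0 p0 A0 B0 iju AA BB.
have -> : i * (j * p) * (A * B) = p * (i * j * (A * B)) by ring.
by rewrite ler_wpM2l// ler_pM ?mulr_ge0// ler_pM.
Qed.

(** The multiplicities and a power of the weight of the mode are bounded by
    powers of the weight of the multiindex that contains this mode, so that a
    bound with a + 2 more powers of the weights suffices. *)
Lemma annih2_le k a M P x y I J : x.1 = y.1 -> decay2 (k + a).+2 M P ->
  normc (annihl x (annihr y P) I J)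
    * (mweight x.1 ^+ a.+1 * (weight I * weight J) ^+ k) <= M.
Proof.
move=> xy PM; apply: le_trans (PM (x +` I)%mset (y +` J)%mset).
rewrite /annihl /annihr /sannih /annih !ComplexField.Normc.normcM !normc_nat.
set u := weight (x +` I)%mset * weight (y +` J)%mset.
have hx := succ_mult_le_weight I x; have hy := succ_mult_le_weight J y.
have u0 : 0 <= u by rewrite mulr_ge0.
have uE : u = mweight x.1 * (mweight x.1 * (weight I * weight J)).
  by rewrite /u !weight1D -xy; ring.
have v1 : 1 <= weight I * weight J by rewrite mulr_ege1// weight_ge1.
have q1 := mweight_ge1 C1_gt0 x.1.
have xyu : (I x).+1%:R * (J y).+1%:R <= u by rewrite ler_pM.
have vu : weight I * weight J <= u.
  by rewrite uE mulrA ler_peMl ?mulr_ge0// mulr_ege1.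
have qu : mweight x.1 <= u by rewrite uE ler_peMr// mulr_ege1.
rewrite [in leRHS](_ : (k + a).+2 = 1 + (a.+1 + k))%N; last first.
  by rewrite add1n addSn addnC.
rewrite !exprD expr1; apply: ler_mul5 => //.
- exact: normc_ge0.
- by rewrite exprn_ge0.
- by rewrite exprn_ge0 ?mulr_ge0.
- by rewrite lerXn2r ?nnegrE.
- by rewrite lerXn2r ?nnegrE ?mulr_ge0.
Qed.

Lemma annih_annih_le k a M F x y I : x.1 = y.1 -> decay (k + a).+3 M F ->
  normc (sannih x (sannih y F) I) * (mweight x.1 ^+ a.+1 * weight I ^+ k) <= M.
Proof.
move=> xy FM; apply: le_trans (FM (y +` (x +` I))%mset).
rewrite /sannih /annih !ComplexField.Normc.normcM !normc_nat.
set u := weight (y +` (x +` I))%mset.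
have u0 : 0 <= u by exact: w0.
have uE : u = mweight x.1 * (mweight x.1 * weight I).
  by rewrite /u !weight1D -xy; ring.
have q1 := mweight_ge1 C1_gt0 x.1.
have hy : ((x +` I)%mset y).+1%:R <= u by exact: succ_mult_le_weight.
have hx : (I x).+1%:R <= u.
  apply: le_trans (succ_mult_le_weight I x) _.
  by rewrite uE weight1D; apply: ler_peMl => //; rewrite mulr_ge0.
have vu : weight I <= u by rewrite uE mulrA ler_peMl ?mulr_ge0// mulr_ege1.
have qu : mweight x.1 <= u by rewrite uE ler_peMr// mulr_ege1// weight_ge1.
rewrite [in leRHS](_ : (k + a).+3 = 2 + (a.+1 + k))%N; last first.
  by rewrite add2n addSn addnC.
rewrite !exprD expr2; apply: ler_mul5 => //.
- exact: normc_ge0.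
- by rewrite exprn_ge0.
- by rewrite exprn_ge0.
- by rewrite ler_pM.
- by rewrite lerXn2r ?nnegrE.
- by rewrite lerXn2r ?nnegrE.
Qed.

End RapidDecay.

(** * Infinite sums over the modes *)

Section ExtendedOperators.
Variables (R : realType) (C1 : R).
Hypothesis C1_gt0 : 0 < C1.
Local Notation C := R[i].
Local Notation normc := ComplexField.Normc.normc.
Local Notation ser := (ser R).
Local Notation arr := (arr R).
Local Notation mweight := (mweight C1).
Local Notation weight := (weight C1).
Implicit Types c d : mode -> C.

Definition growth L a c := forall n, normc (c n) <= L * mweight n ^+ a.

Let w0 I : 0 <= weight I. Proof. exact/ltW/weight_gt0. Qed.
Let wN0 I : 0 < weight I. Proof. exact/weight_gt0. Qed.
Let q0 n : 0 <= mweight n. Proof. exact/ltW/mweight_gt0. Qed.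
Let qN0 n : 0 < mweight n. Proof. exact/mweight_gt0. Qed.
Let qV0 n : 0 <= (mweight n)^-1. Proof. by rewrite invr_ge0. Qed.

Definition laplace_ext c (F : ser) : ser := fun I =>
  csum (fun n => c n * sannih (dirH n) (sannih (dirHdual n) F) I).

Definition bidiff_ext c d (P : arr) : arr := fun I J =>
  csum (fun n => c n * annihl (dirH n) (annihr (dirHdual n) P) I J
               + d n * annihl (dirHdual n) (annihr (dirH n) P) I J).

(** One of the a + 1 powers of the weight of the mode makes the sum over the modes
    converge; the others compensate the growth of the coefficients. *)
Lemma growth_term L a c n (z : C) v M : 0 <= L -> growth L a c -> 0 < v ->
  normc z * (mweight n ^+ a.+1 * v) <= M ->
  normc (c n * z) <= L * M * v^-1 * (mweight n)^-1.
Proof.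
move=> L0 cL v0 zM; rewrite ComplexField.Normc.normcM.
rewrite ler_pdivlMr// ler_pdivlMr//.
apply: le_trans (_ : L * mweight n ^+ a * normc z * mweight n * v <= _).
  by rewrite !ler_wpM2r ?normc_ge0// ltW.
have -> : L * mweight n ^+ a * normc z * mweight n * v
    = L * (normc z * (mweight n ^+ a.+1 * v)) by rewrite exprS; ring.
by rewrite ler_wpM2l.
Qed.

Section Bounds.
Variables (L : R) (a : nat) (c d : mode -> C).
Hypotheses (L0 : 0 <= L) (cL : growth L a c) (dL : growth L a d).

Lemma laplace_term_le k M F I : decay C1 (k + a).+3 M F -> forall n,
  normc (c n * sannih (dirH n) (sannih (dirHdual n) F) I)
    <= L * M * (weight I ^+ k)^-1 * (mweight n)^-1.
Proof.
move=> FM n; apply: growth_term => //; first by rewrite exprn_gt0.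
exact: (annih_annih_le C1_gt0 (x := dirH n) (y := dirHdual n)).
Qed.

Lemma bidiff_term_le k M P I J : decay2 C1 (k + a).+2 M P -> forall n,
  normc (c n * annihl (dirH n) (annihr (dirHdual n) P) I J
         + d n * annihl (dirHdual n) (annihr (dirH n) P) I J)
    <= (2 * (L * M * ((weight I * weight J) ^+ k)^-1)) * (mweight n)^-1.
Proof.
move=> PM n; apply: le_trans (le_normcD _ _) _.
have v0 : 0 < (weight I * weight J) ^+ k by rewrite exprn_gt0// mulr_gt0.
have h1 := annih2_le C1_gt0 I J (erefl n : (dirH n).1 = (dirHdual n).1) PM.
have h2 := annih2_le C1_gt0 I J (erefl n : (dirHdual n).1 = (dirH n).1) PM.
apply: le_trans (lerD (growth_term L0 cL v0 h1) (growth_term L0 dL v0 h2)) _.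
by rewrite [2 * _]mulr_natl mulr2n mulrDl.
Qed.

Lemma decay_laplace_ext k M F : decay C1 (k + a).+3 M F ->
  decay C1 k (2 * usum (fun n => (mweight n)^-1) * L * M) (laplace_ext c F).
Proof.
move=> FM I; have v0 : 0 < weight I ^+ k by rewrite exprn_gt0.
have := csum_le qV0 (finite_total_mode C1_gt0) (laplace_term_le I FM).
by rewrite -ler_pdivlMr// -!mulrA.
Qed.

Lemma decay_bidiff_ext k M P : decay2 C1 (k + a).+2 M P ->
  decay2 C1 k (4 * usum (fun n => (mweight n)^-1) * L * M) (bidiff_ext c d P).
Proof.
move=> PM I J.
have v0 : 0 < (weight I * weight J) ^+ k by rewrite exprn_gt0// mulr_gt0.
have := csum_le qV0 (finite_total_mode C1_gt0) (bidiff_term_le I J PM).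
rewrite -ler_pdivlMr//; set S := usum _; set V := (_ ^+ k)^-1.
by have -> : 2 * S * (2 * (L * M * V)) = 4 * S * L * M * V by ring.
Qed.

Lemma rapid_laplace_ext F : rapid C1 F -> rapid C1 (laplace_ext c F).
Proof.
move=> rF k; have [M FM] := rF (k + a).+3.
by eexists; exact: decay_laplace_ext FM.
Qed.

Lemma rapid_bidiff_ext P : rapid2 C1 P -> rapid2 C1 (bidiff_ext c d P).
Proof.
move=> rP k; have [M PM] := rP (k + a).+2.
by eexists; exact: decay_bidiff_ext PM.
Qed.

Lemma laplace_ext_linear b F G : rapid C1 F -> rapid C1 G ->
  laplace_ext c (b *: F + G) = b *: laplace_ext c F + laplace_ext c G.
Proof.
move=> rF rG; apply/funext => I; rewrite serD serZ /laplace_ext.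
have [M FM] := rF (0 + a).+3; have [N GN] := rG (0 + a).+3.
rewrite -(csum_linear qV0 (finite_total_mode C1_gt0) b
  (laplace_term_le I FM) (laplace_term_le I GN)).
by congr csum; apply/funext => n; rewrite !linearD !linearZ /= !serD !serZ; ring.
Qed.

Lemma bidiff_ext_linear b P Q : rapid2 C1 P -> rapid2 C1 Q ->
  bidiff_ext c d (b *: P + Q) = b *: bidiff_ext c d P + bidiff_ext c d Q.
Proof.
move=> rP rQ; apply/funext => I; apply/funext => J; rewrite arrD arrZ /bidiff_ext.
have [M PM] := rP (0 + a).+2; have [N QN] := rQ (0 + a).+2.
rewrite -(csum_linear qV0 (finite_total_mode C1_gt0) b
  (bidiff_term_le I J PM) (bidiff_term_le I J QN)).
congr csum; apply/funext => n.
have e x y : annihl x (annihr y (b *: P + Q)) I J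
    = b * annihl x (annihr y P) I J + annihl x (annihr y Q) I J.
  by rewrite !linearD !linearZ /= arrD arrZ.
rewrite !e; move: (annihl _ _ _ _) (annihl _ _ _ _) (annihl _ _ _ _) (annihl _ _ _ _).
by move=> *; ring.
Qed.

Lemma iter_bidiff_ext r : exists p K, 0 <= K /\
  forall k M P, decay2 C1 (k + p) M P -> decay2 C1 k (K * M) (iter r (bidiff_ext c d) P).
Proof.
elim: r => [|r [p [K [K0 h]]]].
  by exists 0%N, 1; split=> // k M P; rewrite addn0 mul1r.
exists (a.+2 + p)%N, (4 * usum (fun n => (mweight n)^-1) * L * K); split.
  by rewrite !mulr_ge0//; exact: usum_ge0.
move=> k M P PM; rewrite iterS -[_ * K * M]mulrA; apply: decay_bidiff_ext; apply: h.
by rewrite -2!addnS -addnA.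
Qed.

Lemma rapid_iter_bidiff_ext r P :
  rapid2 C1 P -> rapid2 C1 (iter r (bidiff_ext c d) P).
Proof. by move=> rP; elim: r => //= r; exact: rapid_bidiff_ext. Qed.

Lemma iter_bidiff_ext_linear r b P Q : rapid2 C1 P -> rapid2 C1 Q ->
  iter r (bidiff_ext c d) (b *: P + Q)
    = b *: iter r (bidiff_ext c d) P + iter r (bidiff_ext c d) Q.
Proof.
move=> rP rQ; elim: r => //= r ->.
by rewrite bidiff_ext_linear//; exact: rapid_iter_bidiff_ext.
Qed.

Lemma iter_laplace_ext r : exists p K, 0 <= K /\
  forall k M F, decay C1 (k + p) M F -> decay C1 k (K * M) (iter r (laplace_ext c) F).
Proof.
elim: r => [|r [p [K [K0 h]]]].
  by exists 0%N, 1; split=> // k M P; rewrite addn0 mul1r.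
exists (a.+3 + p)%N, (2 * usum (fun n => (mweight n)^-1) * L * K); split.
  by rewrite !mulr_ge0//; exact: usum_ge0.
move=> k M F FM; rewrite iterS -[_ * K * M]mulrA; apply: decay_laplace_ext; apply: h.
by rewrite -3!addnS -addnA.
Qed.

Definition star_ext r (F G : ser) : ser :=
  swick (iter r (bidiff_ext c d) (stensor F G)).

Lemma rapid_star_ext r F G : rapid C1 F -> rapid C1 G -> rapid C1 (star_ext r F G).
Proof.
by move=> rF rG; apply/(rapid_wick C1_gt0)/rapid_iter_bidiff_ext/rapid_tensor.
Qed.

Lemma decay_star_ext r : exists p K, 0 <= K /\ forall k M N F G,
  decay C1 (k + p) M F -> decay C1 (k + p) N G ->
  decay C1 k (K * (M * N)) (star_ext r F G).
Proof.
have [k0 [S [S0 hS]]] := decay_wick C1_gt0 (R := R).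
have [p [K [K0 hK]]] := iter_bidiff_ext r.
exists (k0 + p)%N, (S * K); split; first by rewrite mulr_ge0.
move=> k M N F G FM GN; rewrite -[S * K * _]mulrA; apply: hS; apply: hK.
by rewrite -addnA; exact: decay_tensor.
Qed.

Lemma star_ext_linearl r b F F' G : rapid C1 F -> rapid C1 F' -> rapid C1 G ->
  star_ext r (b *: F + F') G = b *: star_ext r F G + star_ext r F' G.
Proof.
move=> rF rF' rG; rewrite /star_ext tensorDl tensorZl iter_bidiff_ext_linear.
- by rewrite linearD linearZ.
- exact: rapid_tensor.
- exact: rapid_tensor.
Qed.

Lemma star_ext_linearr r b F G G' : rapid C1 F -> rapid C1 G -> rapid C1 G' ->
  star_ext r F (b *: G + G') = b *: star_ext r F G + star_ext r F G'.
Proof.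
move=> rF rG rG'; rewrite /star_ext tensorDr tensorZr iter_bidiff_ext_linear.
- by rewrite linearD linearZ.
- exact: rapid_tensor.
- exact: rapid_tensor.
Qed.
End Bounds.
End ExtendedOperators.

(* When only the modes of A occur, the sums over all modes are sums over A. *)
Section Support.
Variables (R : realType) (A : seq mode).
Local Notation C := R[i].
Local Notation ser := (ser R).
Local Notation arr := (arr R).

Definition modes_in (I : multiindex) := forall x, x \in I -> x.1 \in A.

Definition supported (F : ser) := forall I, ~ modes_in I -> F I = 0.
Definition supported2 (P : arr) :=
  forall I J, ~ (modes_in I /\ modes_in J) -> P I J = 0.

Lemma modes_in1D x I : modes_in (x +` I)%mset -> x.1 \in A /\ modes_in I.
Proof.
by move=> h; split=> [|y yI]; apply: h; rewrite in_mset1D ?eqxx// yI orbT.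
Qed.

Lemma supported_annih x F : supported F -> supported (sannih x F).
Proof.
move=> sF I nI; rewrite /sannih /annih sF ?mulr0//.
by move=> /modes_in1D[].
Qed.

Lemma annih_notin x F : supported F -> x.1 \notin A -> sannih x F = 0.
Proof.
move=> sF xA; apply/funext => I; rewrite /sannih /annih sF ?mulr0//.
by move=> /modes_in1D[xA' _]; rewrite xA' in xA.
Qed.

Lemma supported2_annihl x P : supported2 P -> supported2 (annihl x P).
Proof.
move=> sP I J nIJ; rewrite /annihl /sannih /annih sP ?mulr0//.
by move=> [/modes_in1D[_ mI] mJ]; apply: nIJ.
Qed.

Lemma supported2_annihr x P : supported2 P -> supported2 (annihr x P).
Proof.
move=> sP I J nIJ; rewrite /annihr /sannih /annih sP ?mulr0//.
by move=> [mI /modes_in1D[_ mJ]]; apply: nIJ.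
Qed.

Lemma annihl_notin x P : supported2 P -> x.1 \notin A -> annihl x P = 0.
Proof.
move=> sP xA; apply/funext => I; apply/funext => J.
rewrite /annihl /sannih /annih sP ?mulr0//.
by move=> [/modes_in1D[xA' _]]; rewrite xA' in xA.
Qed.

Lemma supported_wick P : supported2 P -> supported (swick P).
Proof.
move=> sP I nI; rewrite wickE big_seq big1// => p.
rewrite in_fset_set ?inE; last exact: finite_splits.
move=> pI; apply: sP => -[p1 p2]; apply: nI => x.
by rewrite -(pI : (p.1 `+` p.2)%mset = I) in_msetD => /orP[/p1|/p2].
Qed.

Lemma supported_tensor F G : supported F -> supported G -> supported2 (stensor F G).
Proof.
move=> sF sG I J nIJ; rewrite /stensor /tensor.
have [mI|nI] := pselect (modes_in I); last by rewrite sF ?mul0r.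
by rewrite sG ?mulr0// => mJ; apply: nIJ.
Qed.

Hypothesis uA : uniq A.

Lemma laplace_ext_trunc c F : supported F -> laplace_ext c F = laplace_trunc A c F.
Proof.
move=> sF; apply/funext => I; rewrite /laplace_ext (csum_finite uA).
  rewrite /laplace_trunc; elim: A => [|n B IH]; first by rewrite !big_nil.
  by rewrite !big_cons serD serZ IH.
move=> n nA; rewrite (annih_notin (x := dirH n)) ?mulr0//.
exact: supported_annih.
Qed.

(** Outside of the support all terms vanish, so that the sum is over the empty
    sequence. *)
Lemma supported_laplace_ext c F : supported F -> supported (laplace_ext c F).
Proof.
move=> sF I nI; rewrite /laplace_ext (@csum_finite _ _ [::])// ?big_nil// => n _.
by rewrite (supported_annih _ (supported_annih _ sF)) ?mulr0.
Qed.

Lemma bidiff_ext_trunc c d P : supported2 P ->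
  bidiff_ext c d P = bidiff_trunc A 0 0 c d P.
Proof.
move=> sP; apply/funext => I; apply/funext => J; rewrite /bidiff_ext (csum_finite uA).
  rewrite /bidiff_trunc quad_lrrl; elim: A => [|n B IH]; first by rewrite !big_nil.
  by rewrite !big_cons arrD arrD !arrZ IH.
move=> n nA; rewrite !annihl_notin ?mulr0 ?addr0//; exact: supported2_annihr.
Qed.

Lemma supported2_bidiff_ext c d P : supported2 P -> supported2 (bidiff_ext c d P).
Proof.
move=> sP I J nIJ; rewrite /bidiff_ext (@csum_finite _ _ [::])// ?big_nil// => n _.
by rewrite !(supported2_annihl _ (supported2_annihr _ sP)) ?mulr0 ?addr0.
Qed.

Lemma bidiff_bidiff_ext (lambda : mode -> R) P : supported2 P ->
  bidiff lambda P = bidiff_ext (fun n => (1 + lambda n)%:C%C)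
                               (fun n => (lambda n - 1)%:C%C) P.
Proof.
move=> sP; apply/funext => I; apply/funext => J.
have z n : n \notin A ->
    (1 + lambda n)%:C%C * annihl (dirH n) (annihr (dirHdual n) P) I J
    + (lambda n - 1)%:C%C * annihl (dirHdual n) (annihr (dirH n) P) I J = 0.
  move=> nA; rewrite !annihl_notin ?mulr0 ?addr0//; exact: supported2_annihr.
rewrite /bidiff_ext (csum_finite uA z).
rewrite fsbig_seq//; apply/esym/fsbig_widen => // n [_ /negP nA].
exact: z.
Qed.

End Support.

(** * The topology by weighted sup norms *)

Section HidaTopology.
Variables (R : realType) (C1 : R).
Hypothesis C1_gt0 : 0 < C1.
Local Notation C := R[i].
Local Notation normc := ComplexField.Normc.normc.
Local Notation ser := (ser R).
Local Notation mweight := (mweight C1).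
Local Notation weight := (weight C1).
Local Notation hida := (hida C1).

Let w0 I : 0 <= weight I. Proof. exact/ltW/weight_gt0. Qed.
Let wN0 I : 0 < weight I. Proof. exact/weight_gt0. Qed.

Definition hida_summand (r c : R) (F : ser) (I : multiindex) : R :=
  normc (F I) ^+ 2 * hida_weight C1 r I * c ^+ size (enum_mset I).

Lemma hida_weightE r c I :
  hida_weight C1 r I * c ^+ size (enum_mset I)
    = \prod_(x <- enum_mset I) (Num.sqrt (C1 * (val x.1)%:~R ^+ 2 + 1) `^ r * c).
Proof.
rewrite /hida_weight; elim: (enum_mset I) => [|x s IH].
  by rewrite !big_nil mulr1.
by rewrite !big_cons -IH /= [c ^+ _.+1]exprS; ring.
Qed.

Lemma weightXE k I : weight I ^+ k = \prod_(x <- enum_mset I) mweight x.1 ^+ k.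
Proof. by rewrite /weight prodrXl. Qed.

Let y_ge1 (n : mode) : 1 <= C1 * (val n)%:~R ^+ 2 + 1 :> R.
Proof. by rewrite lerDr mulr_ge0 ?sqr_ge0// ltW. Qed.

Lemma weight_hida_weight k I :
  weight I ^+ (2 * k)
    = hida_weight C1 (4 * k)%:R I * (4 ^+ k) ^+ size (enum_mset I).
Proof.
rewrite hida_weightE weightXE; apply: eq_bigr => x _.
rewrite powR_mulrn ?sqrtr_ge0//.
have -> : (4 * k)%N = (2 * (2 * k))%N by rewrite mulnA.
rewrite [Num.sqrt _ ^+ _]exprM sqr_sqrtr ?(le_trans ler01)//.
rewrite /mweight exprMn mulrC; congr (_ * _).
by rewrite exprM; congr (_ ^+ _); ring.
Qed.

Lemma hida_weight_le r c : 0 < r -> 0 < c -> exists k, forall I,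
  hida_weight C1 r I * c ^+ size (enum_mset I) <= weight I ^+ k.
Proof.
move=> r0 c0; pose a := (Num.truncn r).+1; pose b := (Num.truncn c).+1.
exists (a + b)%N => I; rewrite hida_weightE weightXE.
apply: ler_prod => x _; rewrite mulr_ge0 ?powR_ge0 ?(ltW c0)//=.
have s0 := sqrtr_ge0 (C1 * (val x.1)%:~R ^+ 2 + 1).
have s1 : 1 <= Num.sqrt (C1 * (val x.1)%:~R ^+ 2 + 1).
  by rewrite -[leLHS]sqrtr1 ler_wsqrtr.
rewrite exprD ler_pM ?powR_ge0 ?(ltW c0)//.
  apply: le_trans (_ : Num.sqrt (C1 * (val x.1)%:~R ^+ 2 + 1) `^ a%:R <= _).
    by rewrite ler_powR// ltW// truncnS_gt.
  rewrite powR_mulrn// lerXn2r ?nnegrE ?(ltW (mweight_gt0 C1_gt0 _))//.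
  apply: le_trans (_ : C1 * (val x.1)%:~R ^+ 2 + 1 <= _).
    rewrite -[leRHS]sqr_sqrtr ?(le_trans ler01)//.
    by rewrite expr2 ler_peMr.
  by rewrite /mweight ler_peMl ?(le_trans ler01)// ler1n.
apply: le_trans (_ : 2 ^+ b <= _).
  apply/ltW/(lt_le_trans (truncnS_gt _)).
  by rewrite -natrX ler_nat ltnW// ltn_expl.
by rewrite lerXn2r ?nnegrE ?(ltW (mweight_gt0 C1_gt0 _))// mweight_ge2.
Qed.

Lemma hida_summand_ge0 r c F I : 0 < c -> 0 <= hida_summand r c F I.
Proof. exact: hida_term_ge0. Qed.

Lemma finite_hida_summand r c (F : hida) : 0 < r -> 0 < c ->
  finite_total (hida_summand r c (hcoef F)).
Proof.
by move=> r0 c0; have /asboolP/(_ (r, c)) := hcoefP F; apply.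
Qed.

(** Each Hilbert norm is bounded by a weighted sup norm, because the inverse
    weights are summable. *)
Lemma decay_hida_summand r c : 0 < r -> 0 < c -> exists k K,
  [/\ 0 <= K & forall M (F : ser), decay C1 k M F ->
    finite_total (hida_summand r c F) /\ usum (hida_summand r c F) <= K * M ^+ 2].
Proof.
move=> r0 c0; have [a ha] := hida_weight_le r0 c0.
have [k0 hk0] := nuclear C1_gt0.
pose g I := (weight I ^+ k0)^-1.
have g0 I : 0 <= g I by rewrite invr_ge0 exprn_ge0.
exists (a + k0)%N, (usum g); split=> [|M F FM]; first exact: usum_ge0.
have M0 := decay_ge0 FM.
have le I : hida_summand r c F I <= M ^+ 2 * g I.
  rewrite /g ler_pdivlMr ?exprn_gt0// /hida_summand -mulrA.
  apply: le_trans (_ : normc (F I) ^+ 2 * weight I ^+ a * weight I ^+ k0 <= _).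
    by rewrite ler_wpM2r ?exprn_ge0// ler_wpM2l ?sqr_ge0.
  apply: le_trans (_ : (normc (F I) * weight I ^+ (a + k0)) ^+ 2 <= _).
    rewrite -mulrA -exprD exprMn ler_wpM2l ?sqr_ge0//.
    by rewrite ler_eXnr// exprn_ege1// weight_ge1.
  by rewrite lerXn2r ?nnegrE ?mulr_ge0 ?normc_ge0 ?exprn_ge0.
have Mg : finite_total (fun I => M ^+ 2 * g I).
  by apply: finite_totalZ => //; exact: sqr_ge0.
split; first exact: finite_totalS Mg.
rewrite mulrC -usumZ ?sqr_ge0//; apply: usum_le => // I.
by rewrite hida_summand_ge0 ?le.
Qed.

(** Each weighted sup norm is bounded by a Hilbert norm, because a single term is
    at most the sum.  The shift to k + 1 ensures that the exponent r is positive. *)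
Lemma hida_summand_decay k : exists r c, [/\ 0 < r, 0 < c & forall F : ser,
  finite_total (hida_summand r c F) ->
  decay C1 k (Num.sqrt (usum (hida_summand r c F))) F].
Proof.
exists (4 * k.+1)%:R, (4 ^+ k.+1); split; first by rewrite ltr0n.
  by rewrite exprn_gt0.
move=> F Ffin; have c0 : 0 < 4 ^+ k.+1 :> R by rewrite exprn_gt0.
have T0 I : 0 <= hida_summand (4 * k.+1)%:R (4 ^+ k.+1) F I by exact: hida_summand_ge0.
apply: (@decayW _ _ C1_gt0 k.+1 k) => // I.
rewrite -[leLHS]ger0_norm; last by rewrite mulr_ge0 ?normc_ge0 ?exprn_ge0.
rewrite -sqrtr_sqr ler_wsqrtr// exprMn -exprM [(k.+1 * 2)%N]mulnC.
rewrite weight_hida_weight mulrA.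
by have := sum_le_usum (s := [:: I]) isT T0 Ffin; rewrite big_seq1.
Qed.

Lemma rapid_hcoef (F : hida) : rapid C1 (hcoef F).
Proof.
move=> k; have [r [c [r0 c0 h]]] := hida_summand_decay k.
by eexists; exact/h/finite_hida_summand.
Qed.

Lemma rapid_hida_pred (F : ser) : rapid C1 F -> F \in @hida_pred R C1.
Proof.
move=> rF; apply/asboolP => -[r c] /= [r0 c0].
have [k [K [K0 h]]] := decay_hida_summand r0 c0; have [M FM] := rF k.
exact: (h M F FM).1.
Qed.

(** The inequality (x + y)^2 <= (1 + t) x^2 + (1 + 1/t) y^2, with a parameter t to
    be chosen, serves as the triangle inequality. *)
Lemma usum_hida_summandD r c t (F G : ser) : 0 < c -> 0 < t ->
  finite_total (hida_summand r c F) -> finite_total (hida_summand r c G) ->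
  usum (hida_summand r c (F + G)) <= (1 + t) * usum (hida_summand r c F)
    + (1 + t^-1) * usum (hida_summand r c G).
Proof.
move=> c0 t0 Ffin Gfin.
have T0 H I : 0 <= hida_summand r c H I by exact: hida_summand_ge0.
have t1 : 0 <= 1 + t by rewrite addr_ge0// ltW.
have t2 : 0 <= 1 + t^-1 by rewrite addr_ge0// invr_ge0 ltW.
rewrite -!usumZ// -usumD//.
- apply: usum_le => [I|]; last first.
    apply: finite_totalD; try (by move=> I; rewrite mulr_ge0);
      exact: finite_totalZ.
  rewrite hida_summand_ge0//=.
  pose W := hida_weight C1 r I * c ^+ size (enum_mset I).
  have hT H : hida_summand r c H I = normc (H I) ^+ 2 * W.
    by rewrite /hida_summand /W mulrA.
  rewrite !hT serD; set x := normc (F I); set y := normc (G I).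
  have x0 : 0 <= x by exact: normc_ge0.
  have y0 : 0 <= y by exact: normc_ge0.
  have W0 : 0 <= W by rewrite mulr_ge0 ?hida_weight_ge0 ?exprn_ge0// ltW.
  rewrite [(1 + t) * _]mulrA [(1 + t^-1) * _]mulrA -mulrDl ler_wpM2r//.
  apply: le_trans (_ : (x + y) ^+ 2 <= _).
    by rewrite lerXn2r ?nnegrE ?normc_ge0 ?addr_ge0//; exact: le_normcD.
  rewrite -subr_ge0.
  have -> : (1 + t) * x ^+ 2 + (1 + t^-1) * y ^+ 2 - (x + y) ^+ 2
      = t^-1 * (t * x - y) ^+ 2 by field; rewrite gt_eqF.
  by rewrite mulr_ge0 ?sqr_ge0// invr_ge0 ltW.
- by move=> I; rewrite mulr_ge0.
- by move=> I; rewrite mulr_ge0.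
- exact: finite_totalZ.
- exact: finite_totalZ.
Qed.

Definition toser (F : hida) : ser := hcoef F.

Lemma toserD (F G : hida) : toser (F + G) = toser F + toser G.
Proof. by []. Qed.
Lemma toserN (F : hida) : toser (- F) = - toser F.
Proof. by []. Qed.
Lemma toserB (F G : hida) : toser (F - G) = toser F - toser G.
Proof. by []. Qed.
Lemma toserZ a (F : hida) : toser (a *: F) = a *: toser F.
Proof. by []. Qed.
Lemma toser0 : toser 0 = 0.
Proof. by []. Qed.
Lemma toser_inj : injective toser.
Proof. exact: val_inj. Qed.

Lemma hida_normE r c (F : hida) :
  hida_norm r c F = Num.sqrt (usum (hida_summand r c (toser F))).
Proof. by []. Qed.

(** Write s < e^2 for the squared distance of F and F0.  The parameter t is chosen
    such that (1 + t) s <= (s + e^2) / 2, and then d such that the contribution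
    of G - F is at most (e^2 - s) / 4. *)
Lemma hida_ball_interior (r c e : R) (F0 F : hida) : 0 < r -> 0 < c -> 0 < e ->
  hida_ball r c F0 e F ->
  exists k d, 0 < d /\ forall G, decay C1 k d (toser (G - F)) -> hida_ball r c F0 e G.
Proof.
move=> r0 c0 e0 FF0; pose s := usum (hida_summand r c (toser (F - F0))).
have T0 H I : 0 <= hida_summand r c H I by exact: hida_summand_ge0.
have s0 : 0 <= s by exact: usum_ge0.
have se : s < e ^+ 2.
  have : hida_norm r c (F - F0) < e by [].
  rewrite -(@ltr_pXn2r _ 2%N) ?nnegrE ?sqrtr_ge0 ?(ltW e0)//.
  by rewrite hida_normE sqr_sqrtr.
have [k [K [K0 hK]]] := decay_hida_summand r0 c0.
pose t := (e ^+ 2 - s) / (2 * (s + 1)).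
have s1 : 0 < s + 1 by rewrite ltr_wpDl.
have t0 : 0 < t by rewrite divr_gt0 ?subr_gt0// mulr_gt0.
have ts : t * s <= (e ^+ 2 - s) / 2.
  have -> : t * s = (e ^+ 2 - s) / 2 * (s / (s + 1)) by rewrite /t; field; rewrite gt_eqF.
  rewrite ler_piMr ?divr_ge0 ?subr_ge0 ?(ltW se)//.
  by rewrite ler_pdivrMr// mul1r lerDl.
pose B := (1 + t^-1) * (K + 1).
have B0 : 0 < B by rewrite mulr_gt0 ?ltr_wpDl// ?addr_gt0 ?invr_gt0.
pose d := Num.sqrt ((e ^+ 2 - s) / 4 / B).
have d20 : 0 < (e ^+ 2 - s) / 4 / B by rewrite !divr_gt0// subr_gt0.
exists k, d; split; first by rewrite sqrtr_gt0.
move=> G dG.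
have [Gfin GK] := hK _ _ dG.
have Ffin : finite_total (hida_summand r c (toser (F - F0))) by exact: finite_hida_summand.
have := usum_hida_summandD c0 t0 Ffin Gfin.
rewrite -toserD (_ : F - F0 + (G - F) = G - F0); last first.
  by rewrite addrC addrA subrK.
rewrite -/s => GF0.
suff : usum (hida_summand r c (toser (G - F0))) < e ^+ 2.
  move=> h; rewrite /hida_ball /= hida_normE.
  rewrite -(@ltr_pXn2r _ 2%N) ?nnegrE ?sqrtr_ge0 ?(ltW e0)//.
  by rewrite sqr_sqrtr; last exact: usum_ge0.
have : (1 + t^-1) * usum (hida_summand r c (toser (G - F))) <= (e ^+ 2 - s) / 4.
  apply: le_trans (_ : B * d ^+ 2 <= _).
    rewrite /B -mulrA ler_wpM2l ?addr_ge0 ?invr_ge0 ?(ltW t0)//.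
    apply: le_trans GK _; rewrite ler_wpM2r ?sqr_ge0// lerDl//.
  rewrite /d sqr_sqrtr ?(ltW d20)// mulrC divfK// gt_eqF//.
lra.
Qed.

(** A ball contains a sup norm ball around each of its points, and a finite
    intersection of sup norm balls with the same center contains the one with
    the largest order and the smallest radius.  Conversely each sup norm ball
    contains a ball of a Hilbert norm. *)
Lemma hida_nbhsP (F : hida) (U : set hida) : nbhs F U <->
  exists k d, 0 < d /\ forall G, decay C1 k d (toser (G - F)) -> U G.
Proof.
split.
  rewrite (@nbhsE hida) => -[_ [[B sB <-] [D BD DF]] sU].
  have [E sE IE] := sB _ BD.
  have hE V : V \in E -> exists k d, 0 < d /\
      forall G, decay C1 k d (toser (G - F)) -> V G.
    move=> VE; have := sE _ VE; rewrite inE => -[r [c [e [F0 [r0 c0 e0 VE']]]]].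
    subst V; apply: hida_ball_interior => //.
    by move: DF; rewrite -IE => /(_ _ VE).
  have fin (s : seq (set hida)) :
      (forall V, V \in s -> exists k d, 0 < d /\
        forall G, decay C1 k d (toser (G - F)) -> V G) ->
      exists k d, 0 < d /\ forall G,
        decay C1 k d (toser (G - F)) -> forall V, V \in s -> V G.
    elim: s => [|V s IH] hs; first by exists 0%N, 1; split.
    have [k1 [d1 [d10 h1]]] := hs V (mem_head _ _).
    have [|k2 [d2 [d20 h2]]] := IH.
      by move=> W Ws; apply: hs; rewrite inE Ws orbT.
    exists (maxn k1 k2), (Num.min d1 d2); split; first by rewrite lt_min d10.
    move=> G GF W; rewrite inE => /orP[/eqP ->|Ws].
      by apply: h1; apply: decayW GF => //; rewrite ?leq_maxl// ge_min lexx.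
    by apply: h2 => //; apply: decayW GF => //; rewrite ?leq_maxr// ge_min lexx orbT.
  have [k [d [d0 hd]]] := fin (enum_fset E) hE.
  exists k, d; split=> // G GF; apply: sU.
  have DG : D G by rewrite -IE => V /= VE; exact: (hd G GF V VE).
  by exists D.
move=> [k [d [d0 hU]]]; have [r [c [r0 c0 h]]] := hida_summand_decay k.
rewrite (@nbhsE hida); exists (hida_ball r c F d).
  split.
    exists [set hida_ball r c F d]; last first.
      rewrite predeqE => G; split=> [[_ ->]|GB] //.
      by exists (hida_ball r c F d).
    move=> _ ->; exists [fset hida_ball r c F d]%fset.
      by move=> V; rewrite inE inE => /eqP ->; exists r, c, d, F.
    rewrite predeqE => G; split=> [GI|GB V]; last by rewrite /= inE => /eqP ->.
    by apply: (GI (hida_ball r c F d)); rewrite /= inE.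
  rewrite /hida_ball /= subrr /hida_norm.
  rewrite (_ : fine _ = 0) ?sqrtr0//.
  rewrite /hida_sqnorm esum1// => I _.
  rewrite -[hcoef 0 I]/(0 : C).
  by rewrite ComplexField.Normc.normc0 expr0n /= !mul0r.
move=> G GF; apply: hU.
apply: (decayW C1_gt0 (leqnn _) _ (h _ (finite_hida_summand (G - F) r0 c0))).
exact: ltW.
Qed.

End HidaTopology.

(** * Bounded operators and density of finite sums *)

Lemma finite_superlevel (R : realType) (T : choiceType) (g : T -> R) (d : R) :
  (forall i, 0 <= g i) -> finite_total g -> 0 < d ->
  finite_set [set i | d <= g i].
Proof.
move=> g0 gfin d0; apply: contrapT => inf.
have [B BA Bn] := infinite_set_fset (Num.truncn (usum g / d)).+1 inf.
have := sum_le_usum (fset_uniq B) g0 gfin; apply/negP; rewrite -ltNge.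
apply: (@lt_le_trans _ _ (\sum_(i <- B) d)); last first.
  by rewrite big_seq [leRHS]big_seq; apply: ler_sum => i /BA.
rewrite big_const_seq count_predT iter_addr_0 -mulr_natr mulrC -ltr_pdivrMr//.
by apply: lt_le_trans (truncnS_gt _) _; rewrite ler_nat.
Qed.

Section HidaOperators.
Variables (R : realType) (C1 : R).
Hypothesis C1_gt0 : 0 < C1.
Local Notation C := R[i].
Local Notation normc := ComplexField.Normc.normc.
Local Notation ser := (ser R).
Local Notation mweight := (mweight C1).
Local Notation weight := (weight C1).
Local Notation hida := (hida C1).
Local Notation decay := (decay C1).

Let w0 I : 0 <= weight I. Proof. exact/ltW/weight_gt0. Qed.

(** F' keeps the coefficients of F on the finitely many multiindices where the
    inverse weight to the power k0 is not small.  Elsewhere the decay of F of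
    order k + k0 makes the coefficients small for the norm of order k. *)
Lemma finite_sum_approx (F : hida) k (e : R) : 0 < e -> exists F' : hida,
  [/\ finite_sum (hcoef F'), decay k e (toser (F - F'))
    & forall l M, decay l M (toser F) -> decay l M (toser F')].
Proof.
move=> e0; have [k0 hk0] := nuclear C1_gt0.
have [M FM] := rapid_hcoef C1_gt0 F (k + k0).
have M0 := decay_ge0 FM.
pose S := [set I | e / (M + 1) <= (weight I ^+ k0)^-1].
have M1 : 0 < M + 1 by rewrite ltr_wpDl.
have finS : finite_set S.
  apply: finite_superlevel hk0 _; last by rewrite divr_gt0.
  by move=> I; rewrite invr_ge0 exprn_ge0.
pose f : ser := fun I => if I \in S then toser F I else 0.
have fle l N : decay l N (toser F) -> decay l N f.
  move=> FN I; apply: le_trans (FN I); rewrite /f; case: ifP => // _.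
  by rewrite ComplexField.Normc.normc0 mul0r mulr_ge0 ?normc_ge0 ?exprn_ge0.
have rf : rapid C1 f.
  by move=> l; have [N FN] := rapid_hcoef C1_gt0 F l; exists N; exact: fle.
exists (Hida (rapid_hida_pred C1_gt0 rf)); split => //.
  apply: sub_finite_set finS => I /=; rewrite /f.
  by case: ifPn => [|_ /eqP//]; rewrite inE.
rewrite toserB => I; rewrite -[(_ - _) I]/(toser F I - f I) /f.
case: ifPn => [_|]; first by rewrite subrr ComplexField.Normc.normc0 mul0r ltW.
rewrite notin_setE /S /= subr0 => /negP; rewrite -ltNge => WI.
have W0 : 0 < weight I ^+ k0 by rewrite exprn_gt0// weight_gt0.
have := FM I; rewrite exprD mulrA -ler_pdivlMr// => /le_trans; apply.
apply: le_trans (_ : M * (e / (M + 1)) <= _); first by rewrite ler_wpM2l// ltW.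
rewrite mulrCA ler_piMr ?(ltW e0)// ler_pdivrMr// mul1r lerDl//.
Qed.

Definition bounded_op (T : hida -> hida) := forall k, exists p K, 0 <= K /\
  forall M F, decay p M (toser F) -> decay k (K * M) (toser (T F)).

Definition bounded_biadditive (B : hida -> hida -> hida) :=
  [/\ forall F F' G, B (F + F') G = B F G + B F' G,
      forall F G G', B F (G + G') = B F G + B F G' &
      forall k, exists p K, 0 <= K /\ forall M N F G,
        decay p M (toser F) -> decay p N (toser G) ->
        decay k (K * (M * N)) (toser (B F G))].

Lemma biadditive0l B G : bounded_biadditive B -> B 0 G = 0.
Proof.
by move=> [Bl _ _]; apply: (addrI (B 0 G)); rewrite -Bl !addr0.
Qed.

(** B(F, G) = B(F - F', G) + B(F', G - G') for finite sums F' and G', and the right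
    side is as small as desired when F' and G' approximate F and G. *)
Lemma bounded_biadditive_eq0 B : bounded_biadditive B ->
  (forall F G, finite_sum (hcoef F) -> finite_sum (hcoef G) -> B F G = 0) ->
  forall F G, B F G = 0.
Proof.
move=> [Bl Br Bb] B0 F G; apply: toser_inj; apply/funext => I.
have [p [K [K0 hK]]] := Bb 0%N.
have [M FM] := rapid_hcoef C1_gt0 F p; have [N GN] := rapid_hcoef C1_gt0 G p.
have M0 := decay_ge0 FM; have N0 := decay_ge0 GN.
apply: ComplexField.Normc.eq0_normc; apply/eqP; rewrite eq_le normc_ge0 andbT.
apply/ler_addgt0Pr => e e0; rewrite add0r.
have D0 : 0 < K * (M + N) + 1 by rewrite ltr_wpDl// mulr_ge0// addr_ge0.
pose d := e / (K * (M + N) + 1).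
have d0 : 0 < d by rewrite divr_gt0.
have [F' [finF' FF' F'le]] := finite_sum_approx F p d0.
have [G' [finG' GG' G'le]] := finite_sum_approx G p d0.
have -> : B F G = B (F - F') G + B F' (G - G').
  transitivity (B ((F - F') + F') G); first by rewrite subrK.
  rewrite (Bl (F - F')); congr (B _ _ + _).
  transitivity (B F' ((G - G') + G')); first by rewrite subrK.
  by rewrite (Br _ (G - G')) (B0 F' G')// addr0.
rewrite toserD serD; apply: le_trans (le_normcD _ _) _.
have := hK _ _ _ _ FF' GN I; rewrite expr0 mulr1 => h1.
have := hK _ _ _ _ (F'le _ _ FM) GG' I; rewrite expr0 mulr1 => h2.
apply: le_trans (lerD h1 h2) _.
have -> : K * (d * N) + K * (M * d) = d * (K * (M + N)) by ring.
by rewrite /d mulrAC ler_pdivrMr// ler_wpM2l ?(ltW e0)// lerDl.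
Qed.

Lemma bounded_biadditiveD B B' : bounded_biadditive B -> bounded_biadditive B' ->
  bounded_biadditive (fun F G => B F G + B' F G).
Proof.
move=> [Bl Br Bb] [B'l B'r B'b]; split.
- by move=> F F' G; rewrite Bl B'l addrACA.
- by move=> F G G'; rewrite Br B'r addrACA.
move=> k; have [p [K [K0 hK]]] := Bb k; have [p' [K' [K'0 hK']]] := B'b k.
exists (maxn p p'), (K + K'); split; first exact: addr_ge0.
move=> M N F G FM GN.
have FM1 := decayW C1_gt0 (leq_maxl p p') (lexx M) FM.
have FM2 := decayW C1_gt0 (leq_maxr p p') (lexx M) FM.
have GN1 := decayW C1_gt0 (leq_maxl p p') (lexx N) GN.
have GN2 := decayW C1_gt0 (leq_maxr p p') (lexx N) GN.
have := decay_linear C1_gt0 1 (hK _ _ _ _ FM1 GN1) (hK' _ _ _ _ FM2 GN2).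
by rewrite scale1r ComplexField.Normc.normc1 mul1r -mulrDl.
Qed.

Lemma bounded_biadditive0 : bounded_biadditive (fun _ _ => 0).
Proof.
split; [by move=> *; rewrite addr0|by move=> *; rewrite addr0|].
move=> k; exists k, 0; split=> // M N F G _ _ I; rewrite toser0 mul0r.
by rewrite -[(0 : ser) I]/(0 : C) ComplexField.Normc.normc0 mul0r.
Qed.

Lemma bounded_biadditive_sum n (B : 'I_n -> hida -> hida -> hida) :
  (forall i, bounded_biadditive (B i)) ->
  bounded_biadditive (fun F G => \sum_(i < n) B i F G).
Proof.
move=> hB; rewrite /index_enum; elim: (Finite.enum _) => [|i s IH].
  have -> : (fun F G => \sum_(i <- [::]) B i F G) = (fun _ _ => 0).
    by apply/funext => F; apply/funext => G; rewrite big_nil.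
  exact: bounded_biadditive0.
have -> : (fun F G => \sum_(j <- i :: s) B j F G)
    = (fun F G => B i F G + \sum_(j <- s) B j F G).
  by apply/funext => F; apply/funext => G; rewrite big_cons.
exact: bounded_biadditiveD.
Qed.

Lemma bounded_biadditive_out B (T : {linear hida -> hida}) : bounded_op T ->
  bounded_biadditive B -> bounded_biadditive (fun F G => T (B F G)).
Proof.
move=> bT [Bl Br Bb]; split.
- by move=> F F' G; rewrite Bl linearD.
- by move=> F G G'; rewrite Br linearD.
move=> k; have [p' [K' [K'0 hK']]] := bT k; have [p [K [K0 hK]]] := Bb p'.
exists p, (K' * K); split; first exact: mulr_ge0.
by move=> M N F G FM GN; rewrite -[K' * K * _]mulrA; apply: hK'; exact: hK.
Qed.

Lemma bounded_biadditive_in B (T T' : {linear hida -> hida}) :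
  bounded_op T -> bounded_op T' ->
  bounded_biadditive B -> bounded_biadditive (fun F G => B (T F) (T' G)).
Proof.
move=> bT bT' [Bl Br Bb]; split.
- by move=> F F' G; rewrite linearD Bl.
- by move=> F G G'; rewrite linearD Br.
move=> k; have [q [L [L0 hL]]] := Bb k.
have [p [K [K0 hK]]] := bT q; have [p' [K' [K'0 hK']]] := bT' q.
exists (maxn p p'), (L * (K * K')); split; first by rewrite !mulr_ge0.
move=> M N F G FM GN.
have FM1 := decayW C1_gt0 (leq_maxl p p') (lexx M) FM.
have GN2 := decayW C1_gt0 (leq_maxr p p') (lexx N) GN.
have := hL _ _ _ _ (hK _ _ FM1) (hK' _ _ GN2).
by have -> : L * (K * M * (K' * N)) = L * (K * K') * (M * N) by ring.
Qed.

Lemma bounded_op_scale a : bounded_op (fun F => a *: F).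
Proof.
move=> k; exists k, (normc a); split; first exact: normc_ge0.
move=> M F FM; rewrite toserZ.
have z : decay k 0 (0 : ser).
  by move=> I; rewrite -[(0 : ser) I]/(0 : C) ComplexField.Normc.normc0 mul0r.
by have := decay_linear C1_gt0 a FM z; rewrite !addr0.
Qed.

Lemma bounded_biadditiveZ a B : bounded_biadditive B ->
  bounded_biadditive (fun F G => a *: B F G).
Proof.
move=> hB; apply: (@bounded_biadditive_out B (GRing.scale a : hida -> hida)) => //.
exact: bounded_op_scale.
Qed.

Lemma bounded_op_continuous (T : {linear hida -> hida}) : bounded_op T ->
  continuous (T : hida -> hida).
Proof.
move=> bT F U /(hida_nbhsP C1_gt0)[k [d [d0 hU]]].
apply/(hida_nbhsP C1_gt0); have [p [K [K0 hK]]] := bT k.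
exists p, (d / (K + 1)); split; first by rewrite divr_gt0// ltr_wpDl.
move=> G GF; apply: hU; rewrite -linearB.
apply: (decayW C1_gt0 (leqnn k) _ (hK _ _ GF)).
by rewrite mulrCA ler_piMr ?(ltW d0)// ler_pdivrMr ?mul1r ?lerDl// ltr_wpDl.
Qed.

Lemma bounded_biadditive_continuous B : bounded_biadditive B ->
  continuous (fun p : hida * hida => B p.1 p.2).
Proof.
move=> [Bl Br Bb] [F G] U /= /(hida_nbhsP C1_gt0)[k [d [d0 hU]]].
have [p [K [K0 hK]]] := Bb k.
have [M FM] := rapid_hcoef C1_gt0 F p; have [N GN] := rapid_hcoef C1_gt0 G p.
have M0 := decay_ge0 FM; have N0 := decay_ge0 GN.
have D0 : 0 < K * (1 + N + M) + 1 by rewrite ltr_wpDl// mulr_ge0 ?addr_ge0.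
pose e := Num.min 1 (d / (K * (1 + N + M) + 1)).
have e0 : 0 < e by rewrite lt_min ltr01 divr_gt0.
exists ([set F' | decay p e (toser (F' - F))], [set G' | decay p e (toser (G' - G))]).
  by split; apply/(hida_nbhsP C1_gt0); exists p, e; split.
move=> [F' G'] [FF GG]; apply: hU.
have {}FF : decay p e (toser (F' - F)) := FF.
have {}GG : decay p e (toser (G' - G)) := GG.
rewrite -[toser _]/(toser (B F' G' - B F G)).
have -> : B F' G' - B F G
    = B (F' - F) (G' - G) + B (F' - F) G + B F (G' - G).
  transitivity (B ((F' - F) + F) ((G' - G) + G) - B F G); first by rewrite !subrK.
  by rewrite (Bl (F' - F)) !(Br _ (G' - G)) [in LHS]addrA addrK.
have h1 := hK _ _ _ _ FF GG; have h2 := hK _ _ _ _ FF GN.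
have h3 := hK _ _ _ _ FM GG.
have := decay_linear C1_gt0 1 (decay_linear C1_gt0 1 h1 h2) h3.
rewrite !scale1r ComplexField.Normc.normc1 !mul1r => h.
rewrite !toserD; apply: (decayW C1_gt0 (leqnn k) _ h).
have e1 : e <= 1 by rewrite ge_min lexx.
have ed : e * (K * (1 + N + M) + 1) <= d.
  by rewrite -ler_pdivlMr// ge_min lexx orbT.
apply: le_trans ed; rewrite [leRHS](_ : _ = K * e + K * (e * N) + K * (M * e) + e); last by ring.
have ee : K * (e * e) <= K * e by rewrite ler_wpM2l// ler_piMl// ltW.
lra.
Qed.

(** Near (F, G) there is a pair of finite sums, where the two extensions take the
    same value. *)
Lemma continuous_extension_unique (B : coef R -> coef R -> coef R)
    (G1 G2 : hida -> hida -> hida) :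
  continuous_extension B G1 -> continuous_extension B G2 -> G1 = G2.
Proof.
move=> [_ c1 e1] [_ c2 e2]; apply/funext => F; apply/funext => G.
apply: toser_inj; apply/funext => I; apply/eqP; rewrite -subr_eq0; apply/eqP.
apply: ComplexField.Normc.eq0_normc; apply/eqP; rewrite eq_le normc_ge0 andbT.
apply/ler_addgt0Pr => e e0; rewrite add0r.
have e20 : 0 < e / 2 by rewrite divr_gt0.
have nb (H : hida -> hida -> hida) :
    continuous (fun p : hida * hida => H p.1 p.2) ->
    nbhs (F, G) [set p | decay 0 (e / 2) (toser (H p.1 p.2 - H F G))].
  move=> cH; apply: (cH (F, G) [set X | decay 0 (e / 2) (toser (X - H F G))]).
  by apply/(hida_nbhsP C1_gt0); exists 0%N, (e / 2).
have [[U V] /= [UF VG] UV] := filterI (nb _ c1) (nb _ c2).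
have [k [d [d0 hU]]] := (hida_nbhsP C1_gt0 _ _).1 UF.
have [l [d' [d'0 hV]]] := (hida_nbhsP C1_gt0 _ _).1 VG.
have opp m (x : R) (X Y : hida) :
    decay m x (toser (X - Y)) -> decay m x (toser (Y - X)).
  by move=> h J; have := h J; rewrite -opprB toserN -[(- _) J]/(- _) normcN.
have [F' [finF /opp FF' _]] := finite_sum_approx F k d0.
have [G' [finG /opp GG' _]] := finite_sum_approx G l d'0.
have [/= h1 h2] := UV (F', G') (conj (hU _ FF') (hV _ GG')).
have E : toser (G1 F' G') = toser (G2 F' G') by rewrite /toser e1// e2.
have -> : toser (G1 F G) I - toser (G2 F G) I
    = toser (G2 F' G' - G2 F G) I - toser (G1 F' G' - G1 F G) I.
  rewrite !toserB E.
  rewrite -[X in _ = X - _]/(toser (G2 F' G') I - toser (G2 F G) I).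
  rewrite -[X in _ = _ - X]/(toser (G2 F' G') I - toser (G1 F G) I).
  have gen (x y z : C) : x - y = z - y - (z - x) by ring.
  exact: gen.
rewrite [leRHS]splitr; apply: le_trans (le_normcD _ _) _.
rewrite normcN; apply: lerD.
  by have := h2 I; rewrite expr0 mulr1.
by have := h1 I; rewrite expr0 mulr1.
Qed.

End HidaOperators.

(** * The star products and the equivalence operator *)

Lemma finite_sum_supported (R : realType) (F : coef R) : finite_sum F ->
  exists A : seq mode, supported A F.
Proof.
move=> finF; pose S := fset_set [set I | F I != 0].
exists [seq x.1 | x <- flatten [seq enum_mset I' | I' <- S]] => I nI.
apply/eqP; apply: contra_notT nI => FI x xI; apply/map_f/flattenP.
exists (enum_mset I); last by rewrite -has_pred1 has_count count_mem_mset -in_mset.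
by apply/mapP; exists I => //; rewrite in_fset_set// inE.
Qed.

Lemma supportedW (R : realType) (A A' : seq mode) (F : ser R) :
  {subset A <= A'} -> supported A F -> supported A' F.
Proof.
by move=> AA sF I nI; apply: sF => mI; apply: nI => x /mI; exact: AA.
Qed.

Section Star.
Variables (R : realType) (C1 : R).
Hypothesis C1_gt0 : 0 < C1.
Local Notation C := R[i].
Local Notation normc := ComplexField.Normc.normc.
Local Notation ser := (ser R).
Local Notation mweight := (mweight C1).
Local Notation hida := (hida C1).
Local Notation decay := (decay C1).

Variables (L : R) (a : nat).
Hypothesis L0 : 0 <= L.

(** The coefficients of a_n^1 (x) a_n^2 and a_n^2 (x) a_n^1 in the operator of the
    star product. *)
Definition plus1 (lambda : mode -> R) (n : mode) : C := (1 + lambda n)%:C%C.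
Definition minus1 (lambda : mode -> R) (n : mode) : C := (lambda n - 1)%:C%C.

Section Extension.
Variable lambda : mode -> R.
Hypothesis lambda_le : forall n, `|lambda n| <= L * mweight n ^+ a.

Let L1 : 0 <= 1 + L. Proof. exact: addr_ge0. Qed.

Let growth1 (x y : R) : `|x| <= 1 -> 1 <= y -> forall z, `|z| <= L * y ->
  `|x + z| <= (1 + L) * y.
Proof.
move=> x1 y1 z zL; apply: le_trans (ler_normD _ _) _.
by rewrite mulrDl mul1r lerD// (le_trans x1).
Qed.

Let plus1_growth : growth C1 (1 + L) a (plus1 lambda).
Proof.
move=> n; rewrite normc_real; apply: growth1 => //; first by rewrite normr1.
by rewrite exprn_ege1// mweight_ge1.
Qed.

Let minus1_growth : growth C1 (1 + L) a (minus1 lambda).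
Proof.
move=> n; rewrite normc_real addrC; apply: growth1 => //.
  by rewrite normrN normr1.
by rewrite exprn_ege1// mweight_ge1.
Qed.

Definition hida_star r (F G : hida) : hida :=
  Hida (rapid_hida_pred C1_gt0
    (rapid_star_ext C1_gt0 L1 plus1_growth minus1_growth r
       (rapid_hcoef C1_gt0 F) (rapid_hcoef C1_gt0 G))).

Lemma toser_hida_star r F G : toser (hida_star r F G)
  = star_ext (plus1 lambda) (minus1 lambda) r (toser F) (toser G).
Proof. by []. Qed.

Lemma hida_star_linearl r b F F' G :
  hida_star r (b *: F + F') G = b *: hida_star r F G + hida_star r F' G.
Proof.
apply: toser_inj; rewrite toserD toserZ !toser_hida_star toserD toserZ.
by apply: (star_ext_linearl C1_gt0 L1 plus1_growth minus1_growth);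
  exact: rapid_hcoef.
Qed.

Lemma hida_star_linearr r b F G G' :
  hida_star r F (b *: G + G') = b *: hida_star r F G + hida_star r F G'.
Proof.
apply: toser_inj; rewrite toserD toserZ !toser_hida_star toserD toserZ.
by apply: (star_ext_linearr C1_gt0 L1 plus1_growth minus1_growth);
  exact: rapid_hcoef.
Qed.

Lemma hida_star_bounded r : bounded_biadditive (hida_star r).
Proof.
split.
- by move=> F F' G; have := hida_star_linearl r 1 F F' G; rewrite !scale1r.
- by move=> F G G'; have := hida_star_linearr r 1 F G G'; rewrite !scale1r.
move=> k; have [p [K [K0 hK]]] :=
  decay_star_ext C1_gt0 L1 plus1_growth minus1_growth r.
by exists (k + p)%N, K; split=> // M N F G FM GN; exact: hK.
Qed.

Lemma hida_star_extension r : continuous_extension (Cfin lambda r) (hida_star r).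
Proof.
split.
- split=> [G b F F'|F b G G']; first exact: hida_star_linearl.
  exact: hida_star_linearr.
- exact/bounded_biadditive_continuous/hida_star_bounded.
move=> F G /finite_sum_supported[A sF] /finite_sum_supported[A' sG].
pose B := undup (A ++ A').
have {}sF : supported B (toser F).
  by apply: supportedW sF => x xA; rewrite mem_undup mem_cat xA.
have {}sG : supported B (toser G).
  by apply: supportedW sG => x xA; rewrite mem_undup mem_cat xA orbT.
have sP : supported2 B (stensor (toser F) (toser G)) by exact: supported_tensor.
have uB : uniq B by exact: undup_uniq.
suff [E _] : iter r (bidiff lambda) (stensor (toser F) (toser G))
    = iter r (bidiff_ext (plus1 lambda) (minus1 lambda))
        (stensor (toser F) (toser G))
    /\ supported2 B (iter r (bidiff_ext (plus1 lambda) (minus1 lambda))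
        (stensor (toser F) (toser G))).
  have W := congr1 (@wick R) (esym E).
  exact: W.
elim: r => //= r [-> sr]; split; last exact: supported2_bidiff_ext.
exact: (bidiff_bidiff_ext uB).
Qed.

Lemma CA_hida_star r : CA lambda r = hida_star r.
Proof.
apply: (continuous_extension_unique C1_gt0) (hida_star_extension r).
by apply: xgetPex; exists (hida_star r); exact: hida_star_extension.
Qed.

Lemma toser_CA r (F G : hida) : toser (CA lambda r F G)
  = star_ext (plus1 lambda) (minus1 lambda) r (toser F) (toser G).
Proof. by rewrite CA_hida_star. Qed.

Lemma CA_bounded r : bounded_biadditive (CA lambda r : hida -> hida -> hida).
Proof. by rewrite CA_hida_star; exact: hida_star_bounded. Qed.

End Extension.

Section Laplace.
Variable c : mode -> C.
Hypothesis cL : growth C1 L a c.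

Definition hida_laplace (F : hida) : hida :=
  Hida (rapid_hida_pred C1_gt0
    (rapid_laplace_ext C1_gt0 L0 cL (rapid_hcoef C1_gt0 F))).

Lemma hida_laplace_is_linear : linear hida_laplace.
Proof.
move=> b F G; apply: toser_inj; rewrite toserD toserZ.
by apply: (laplace_ext_linear C1_gt0 L0 cL); exact: rapid_hcoef.
Qed.
HB.instance Definition _ :=
  GRing.isLinear.Build C hida hida _ hida_laplace hida_laplace_is_linear.

(** The coefficient T_r of h^r in exp(- h D), for c = - lambda. *)
Definition exp_laplace r (F : hida) : hida := divpow hida_laplace r F.

Lemma exp_laplace_is_linear r : linear (exp_laplace r).
Proof.
move=> b F G; rewrite /exp_laplace /divpow.
have -> : iter r hida_laplace (b *: F + G)
    = b *: iter r hida_laplace F + iter r hida_laplace G.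
  by elim: r => //= r ->; rewrite linearP.
by rewrite scalerDr !scalerA mulrC.
Qed.
HB.instance Definition _ r :=
  GRing.isLinear.Build C hida hida _ (exp_laplace r) (exp_laplace_is_linear r).

Lemma toser_exp_laplace r F :
  toser (exp_laplace r F) = divpow (laplace_ext c) r (toser F).
Proof.
rewrite /exp_laplace /divpow toserZ; congr (_ *: _).
by elim: r => //= r <-.
Qed.

Lemma exp_laplace_bounded r : bounded_op (exp_laplace r).
Proof.
move=> k; have [p [K [K0 hK]]] := iter_laplace_ext C1_gt0 L0 cL r.
have [q [K' [K'0 hK']]] := @bounded_op_scale R C1 C1_gt0 (r`!%:R^-1) k.
have [p' [K'' [K''0 hK'']]] : exists p K, 0 <= K /\ forall M F,
    decay p M (toser F) -> decay q (K * M) (toser (iter r hida_laplace F)).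
  exists (q + p)%N, K; split=> // M F FM.
  have -> : toser (iter r hida_laplace F) = iter r (laplace_ext c) (toser F).
    by elim: (r) => //= i <-.
  exact: hK.
exists p', (K' * K''); split; first exact: mulr_ge0.
by move=> M F FM; rewrite -[K' * K'' * M]mulrA; apply: hK'; exact: hK''.
Qed.

End Laplace.
End Star.

Section Truncation.
Variables (R : realType) (A : seq mode).
Hypothesis uA : uniq A.
Local Notation C := R[i].

Lemma divpow_laplace_trunc (c : mode -> C) r F : supported A F ->
  divpow (laplace_ext c) r F = divpow (laplace_trunc A c) r F
  /\ supported A (divpow (laplace_ext c) r F).
Proof.
move=> sF; rewrite /divpow.
have [E sr] : iter r (laplace_ext c) F = iter r (laplace_trunc A c) F
    /\ supported A (iter r (laplace_ext c) F).
  elim: r => //= r [E sr]; rewrite -E -(laplace_ext_trunc uA c sr).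
  by split=> //; exact: supported_laplace_ext.
by rewrite -E; split=> // I nI; rewrite serZ sr// mulr0.
Qed.

Lemma star_ext_divpow (c d : mode -> C) r F G : supported A F -> supported A G ->
  r`!%:R^-1 *: star_ext c d r F G
    = swick (divpow (bidiff_trunc A 0 0 c d) r (stensor F G)).
Proof.
move=> sF sG; rewrite /star_ext /divpow linearZ; congr (_ *: swick _).
have sP := supported_tensor sF sG.
suff [] : iter r (bidiff_ext c d) (stensor F G)
    = iter r (bidiff_trunc A 0 0 c d) (stensor F G)
    /\ supported2 A (iter r (bidiff_ext c d) (stensor F G)) by [].
elim: r => //= r [E sr]; rewrite -E -(bidiff_ext_trunc uA c d sr).
by split=> //; exact: supported2_bidiff_ext.
Qed.

End Truncation.

(** * The intertwining identity *)

Section Intertwining.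
Variables (R : realType) (C1 : R).
Hypothesis C1_gt0 : 0 < C1.
Local Notation C := R[i].
Local Notation ser := (ser R).
Local Notation hida := (hida C1).
Variables (L : R) (a : nat) (lambda : mode -> R).
Hypothesis L0 : 0 <= L.
Hypothesis lambda_le : forall n, `|lambda n| <= L * mweight C1 n ^+ a.

Definition minus_lambda (n : mode) : C := (- lambda n)%:C%C.

Lemma minus_lambda_growth : growth C1 L a minus_lambda.
Proof. by move=> n; rewrite normc_real normrN. Qed.

Let zero_le n : `|0 : R| <= L * mweight C1 n ^+ a.
Proof. by rewrite normr0 mulr_ge0// exprn_ge0// ltW// mweight_gt0. Qed.

Let T r : {linear hida -> hida} :=
  exp_laplace C1_gt0 L0 minus_lambda_growth r.

Lemma toser_sum n (F : 'I_n -> hida) :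
  toser (\sum_(i < n) F i) = \sum_(i < n) toser (F i).
Proof. exact: (big_morph _ (@toserD R C1) (@toser0 R C1)). Qed.

Let lambdaC : mode -> C := fun n => (lambda n)%:C%C.

Let minus_lambdaE : minus_lambda = - lambdaC.
Proof. by apply/funext => n; rewrite /minus_lambda rmorphN. Qed.
Let plus1E : plus1 lambda = 1 + lambdaC.
Proof. by apply/funext => n; rewrite /plus1 rmorphD rmorph1. Qed.
Let minus1E : minus1 lambda = lambdaC - 1.
Proof. by apply/funext => n; rewrite /minus1 rmorphB rmorph1. Qed.
Let plus10 : plus1 (fun=> 0 : R) = 1 :> (mode -> C).
Proof. by apply/funext => n; rewrite /plus1 addr0 rmorph1. Qed.
Let minus10 : minus1 (fun=> 0 : R) = - 1 :> (mode -> C).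
Proof. by apply/funext => n; rewrite /minus1 sub0r rmorphN rmorph1. Qed.

(** The coefficient of h^m of T(F *^A G) = (T F) * (T G), for F and G without h.
    On finite sums only the modes of a finite set B occur, and the identity is
    the truncated one. *)
Lemma intertwining m (F G : hida) :
  \sum_(i < m.+1) T i ((m - i)`!%:R^-1 *: CA lambda (m - i) F G)
  = \sum_(r < m.+1) \sum_(k < (m - r).+1)
      r`!%:R^-1 *: CA (fun=> 0) r (T k F) (T (m - r - k) G).
Proof.
apply/eqP; rewrite -subr_eq0 -[X in _ + X]scaleN1r; apply/eqP.
have CAb r := CA_bounded C1_gt0 L0 lambda_le r.
have CA0b r := CA_bounded C1_gt0 L0 zero_le r.
have Tb r : bounded_op (T r) by exact: exp_laplace_bounded.
move: F G; apply: (bounded_biadditive_eq0 C1_gt0).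
  apply: (bounded_biadditiveD C1_gt0).
    apply: (bounded_biadditive_sum C1_gt0) => i.
    apply: (bounded_biadditive_out (T := T i)) => //.
    exact: (bounded_biadditiveZ C1_gt0).
  apply: (bounded_biadditiveZ C1_gt0).
  apply: (bounded_biadditive_sum C1_gt0) => r.
  apply: (bounded_biadditive_sum C1_gt0) => k.
  apply: (bounded_biadditiveZ C1_gt0).
  exact: (bounded_biadditive_in C1_gt0 (T := T k) (T' := T (m - r - k))).
move=> F G /finite_sum_supported[A sF] /finite_sum_supported[A' sG].
pose B := undup (A ++ A').
have uB : uniq B by exact: undup_uniq.
have {}sF : supported B (toser F).
  by apply: supportedW sF => x xA; rewrite mem_undup mem_cat xA.
have {}sG : supported B (toser G).
  by apply: supportedW sG => x xA; rewrite mem_undup mem_cat xA orbT.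
apply/eqP; rewrite scaleN1r subr_eq0; apply/eqP/toser_inj.
rewrite !toser_sum.
transitivity (\sum_(i < m.+1) divpow (laplace_trunc B (- lambdaC)) i
    (swick (divpow (bidiff_trunc B 0 0 (1 + lambdaC) (lambdaC - 1)) (m - i)
      (stensor (toser F) (toser G))))).
  apply: eq_bigr => i _.
  rewrite toser_exp_laplace toserZ (toser_CA C1_gt0 L0 lambda_le).
  rewrite (star_ext_divpow uB _ _ _ sF sG) minus_lambdaE -plus1E -minus1E.
  apply: (divpow_laplace_trunc uB _ _ _).1.
  rewrite -(star_ext_divpow uB _ _ _ sF sG) => I nI; rewrite serZ.
  rewrite (_ : star_ext _ _ _ _ _ I = 0) ?mulr0//.
  apply: supported_wick nI.
  elim: (m - i)%N => [|r]; first exact: supported_tensor.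
  exact: supported2_bidiff_ext.
rewrite truncated_intertwining; apply: eq_bigr => r _; rewrite toser_sum.
apply: eq_bigr => k _.
rewrite toserZ (toser_CA C1_gt0 L0 zero_le) plus10 minus10 !toser_exp_laplace.
have [E1 s1] := divpow_laplace_trunc uB minus_lambda k sF.
have [E2 s2] := divpow_laplace_trunc uB minus_lambda (m - r - k) sG.
by rewrite (star_ext_divpow uB _ _ _ s1 s2) E1 E2 minus_lambdaE.
Qed.

Lemma biadditive_suml n B (F : 'I_n -> hida) G : bounded_biadditive B ->
  B (\sum_(i < n) F i) G = \sum_(i < n) B (F i) G.
Proof.
move=> hB; have [Bl _ _] := hB.
exact: (big_morph (B^~ G) (fun F F' => Bl F F' G) (biadditive0l G hB)).
Qed.

Lemma biadditive_sumr n B F (G : 'I_n -> hida) : bounded_biadditive B ->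
  B F (\sum_(i < n) G i) = \sum_(i < n) B F (G i).
Proof.
move=> [_ Br _]; apply: (big_morph (B F) (Br F)).
by apply: (addrI (B F 0)); rewrite -Br !addr0.
Qed.

Lemma series_intertwining (F1 F2 : hida_series C1) :
  series_op T (star lambda F1 F2) = moyal (series_op T F1) (series_op T F2).
Proof.
apply/funext => n; rewrite /moyal /star /series_op.
have CA0b r := CA_bounded C1_gt0 L0 zero_le r.
transitivity (\sum_(i < n.+1) \sum_(r < (n - i).+1) \sum_(j < (n - i - r).+1)
    T i (r`!%:R^-1 *: CA lambda r (F1 j) (F2 (n - i - r - j)%N))).
  apply: eq_bigr => i _; rewrite linear_sum; apply: eq_bigr => r _.
  by rewrite linear_sum.
(* First i + r = m is collected, for the use of the identity in degree m. *)
rewrite (triangular_assoc n (fun i r s => \sum_(j < s.+1)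
  T i (r`!%:R^-1 *: CA lambda r (F1 j) (F2 (s - j)%N)))).
under eq_bigr do rewrite exchange_big /=.
under eq_bigr do under eq_bigr do rewrite intertwining.
under eq_bigr do rewrite exchange_big /=.
rewrite -(triangular_assoc n (fun r s t => \sum_(j < t.+1) \sum_(k < s.+1)
  r`!%:R^-1 *: CA (fun=> 0) r (T k (F1 j)) (T (s - k)%N (F2 (t - j)%N)))).
apply: eq_bigr => r _.
rewrite (triangular_interchange (n - r) (fun k l j t =>
  r`!%:R^-1 *: CA (fun=> 0) r (T k (F1 j)) (T l (F2 t)))).
apply: eq_bigr => i _.
rewrite (biadditive_suml _ _ (CA0b r)) scaler_sumr; apply: eq_bigr => k _.
by rewrite (biadditive_sumr _ _ (CA0b r)) scaler_sumr.
Qed.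

Lemma exp_laplace_continuous r : continuous (T r : hida -> hida).
Proof. exact/(bounded_op_continuous C1_gt0)/exp_laplace_bounded. Qed.

Lemma exp_laplace0 : T 0%N =1 id.
Proof. by move=> F; rewrite /T /= /exp_laplace /divpow /= fact0 invr1 scale1r. Qed.

End Intertwining.

Theorem proposition2 (R : realType) (C1 : R) (hC1 : 0 < C1)
    (lambda : mode -> R)
    (hlambda : exists C alpha : R, forall n : mode,
       `|lambda n| <= C * (`|val n|%N%:R) `^ alpha) :
  exists T : nat -> {linear hida C1 -> hida C1},
    [/\ T 0%N =1 id,
        forall r : nat, continuous (T r : hida C1 -> hida C1) &
        forall F1 F2 : hida_series C1,
          series_op T (star lambda F1 F2)
            = moyal (series_op T F1) (series_op T F2)].
Proof.
have [L [a [L0 hL]]] := growth_le_mweight hC1 hlambda.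
exists (fun r => exp_laplace hC1 L0 (minus_lambda_growth hL) r); split.
- exact: exp_laplace0.
- exact: exp_laplace_continuous.
- exact: series_intertwining.
Qed.
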